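(* Suppose $1\leq p<\infty$ and $1\leq q\leq\infty$ (when $p=1$, assume in addition $q<\infty$). Then $L_{p,q}(0,1)$ contains a copy of $\ell_2$ that does stable phase retrieval. If, in addition, $1\leq p<r<2$, then $L_{p,q}(0,1)$ contains a copy of $\ell_r$ that does stable phase retrieval.
   Context: All spaces are real. $L_{p,q}(0,1)$ is the Lorentz space of (classes of) measurable functions $f$ on $(0,1)$ with Lebesgue measure for which $\|f\|_{p,q}<\infty$, where $\|f\|_{p,q}=\big(\frac qp\int_0^1 (t^{1/p}f^*(t))^q\,\frac{dt}{t}\big)^{1/q}$ for $q<\infty$ and $\|f\|_{p,\infty}=\sup_{0<t<1}t^{1/p}f^*(t)$, $f^*$ being the decreasing rearrangement of $|f|$ (this functional is in general a quasi-norm; replacing it by an equivalent one does not affect the statement). A copy of $\ell_r$ is a closed subspace linearly isomorphic (homeomorphic) to $\ell_r$. A subspace $E$ of $X=L_{p,q}(0,1)$ does stable phase retrieval (SPR) if there is a constant $C$ such that $\min_{\lambda\in\{1,-1\}}\|f-\lambda g\|\leq C\big\||f|-|g|\big\|$ for all $f,g\in E$. *)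

(* Defs.v *)
From HB Require Import structures.
From mathcomp Require Import all_boot all_order all_algebra.
From mathcomp Require Import all_classical all_reals all_analysis.

Set Implicit Arguments.
Unset Strict Implicit.
Unset Printing Implicit Defensive.

Import Order.TTheory GRing.Theory Num.Theory.
Import numFieldNormedType.Exports.

Local Open Scope classical_set_scope.
Local Open Scope ring_scope.

Section lorentz.
Context {R : realType}.
Implicit Types (p s t : R) (q : \bar R) (f g : R -> R).

(* Functions on (0,1) are given by functions R -> R, only the restriction to
   `]0, 1[ being relevant; their classes modulo almost everywhere equality are
   handled through representatives. *)

Definition I01 : set R := `]0, 1[%classic.

Definition ae_eq01 f g : Prop := ae_eq lebesgue_measure I01 f g.

Definition distribution01 f s : \bar R :=
  lebesgue_measure (I01 `&` [set x | s < `|f x|]).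

Definition rearrangement f t : \bar R :=
  ereal_inf [set s%:E | s in [set s | 0 <= s /\ (distribution01 f s <= t%:E)%E]].

Definition lorentz_norm p q f : \bar R :=
  match q with
  | q%:E => (((q / p)%:E *
      \int[lebesgue_measure]_(t in I01)
        (((t `^ p^-1)%:E * rearrangement f t) `^ q * (t^-1)%:E)) `^ q^-1)%E
  | +oo%E => ereal_sup [set ((t `^ p^-1)%:E * rearrangement f t)%E | t in I01]
  | -oo%E => 0%E (* junk value *)
  end.

Definition lorentz p q : set (R -> R) :=
  [set f | measurable_fun I01 f /\ (lorentz_norm p q f < +oo)%E].

(* Linear subspaces of the space of classes correspond to linear subspaces of
   the space of functions that are saturated for a.e. equality. *)
Definition lorentz_subspace p q (E : set (R -> R)) : Prop :=
  [/\ E `<=` lorentz p q,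
      E (cst 0),
      forall (a : R) f g, E f -> E g -> E ((a \*o f) \+ g) &
      forall f g, E f -> measurable_fun I01 g -> ae_eq01 f g -> E g].

Definition lorentz_closed p q (E : set (R -> R)) : Prop :=
  forall f, lorentz p q f ->
    (forall e : R, 0 < e ->
       exists2 g, E g & (lorentz_norm p q (f \- g)%R < e%:E)%E) ->
    E f.

Definition ell (r : R) : set (nat -> R) :=
  [set x | x \in Lfun (@counting nat R) r%:E].

Definition ell_norm (r : R) (x : nat -> R) : \bar R :=
  ('N[@counting nat R]_r%:E [EFin \o x])%E.

(* T maps an element of ell_r to a representative of its image, so that the
   linearity, injectivity and surjectivity of T are stated modulo a.e.
   equality; the last two clauses are the continuity of T and of its inverse. *)
Definition linear_homeomorphism p q (r : R) (E : set (R -> R))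
    (T : (nat -> R) -> (R -> R)) : Prop :=
  [/\ forall x, ell r x -> E (T x),
      forall (a : R) x y, ell r x -> ell r y ->
        ae_eq01 (T ((a \*o x) \+ y)) ((a \*o T x) \+ T y),
      (forall x y, ell r x -> ell r y -> ae_eq01 (T x) (T y) -> x = y) /\
      (forall f, E f -> exists2 x, ell r x & ae_eq01 (T x) f),
      forall x, ell r x -> forall e : R, 0 < e -> exists2 d : R, 0 < d &
        forall y, ell r y -> (ell_norm r (x \- y)%R < d%:E)%E ->
          (lorentz_norm p q (T x \- T y)%R < e%:E)%E &
      forall x, ell r x -> forall e : R, 0 < e -> exists2 d : R, 0 < d &
        forall y, ell r y -> (lorentz_norm p q (T x \- T y)%R < d%:E)%E ->
          (ell_norm r (x \- y)%R < e%:E)%E].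

Definition copy_of_ell p q (r : R) (E : set (R -> R)) : Prop :=
  [/\ lorentz_subspace p q E,
      lorentz_closed p q E &
      exists T, linear_homeomorphism p q r E T].

Definition stable_phase_retrieval p q (E : set (R -> R)) : Prop :=
  exists C : R, forall f g, E f -> E g ->
    (Order.min (lorentz_norm p q (f \- g)%R) (lorentz_norm p q (f \+ g)%R) <=
     C%:E * lorentz_norm p q ((Num.norm \o f) \- (Num.norm \o g))%R)%E.

End lorentz.

(* Main.v *)
Require Import Defs.
From HB Require Import structures.
From mathcomp Require Import all_boot all_order all_algebra.
From mathcomp Require Import all_classical all_reals all_analysis.
From mathcomp Require Import measurable_realfun.
From mathcomp Require Import ring lra.

Set Implicit Arguments.
Unset Strict Implicit.
Unset Printing Implicit Defensive.

Import Order.TTheory GRing.Theory Num.Theory.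
Import numFieldNormedType.Exports.

Local Open Scope classical_set_scope.
Local Open Scope ring_scope.

(** The subspaces are spans of random series.  Lebesgue measure makes (0,1) a
    probability space; let X_0, X_1, ... be independent copies of a symmetric
    random variable X and put T x = sum_i x_i X_i.  Two facts about X suffice.

    - Tails: P(sup_n |sum_(i<n) x_i X_i| >= s) <= C (|x|_r / s)^m for some
      m > p.  Then the series converges in probability, and T x lies in
      L_(p,q) with quasi-norm at most K |x|_r, because a tail of order m > p
      is integrable enough for every second index q.
    - Non-concentration: for two sequences x, x' the event
      {|T x| > d |x|_r and |T x'| > d |x'|_r} has probability at least c > 0.

    With x = x' the second fact bounds the quasi-norm of T x from below, so T
    is an isomorphism onto its range.  It also gives stable phase retrieval:
    pointwise | |f| - |g| | = min(|f - g|, |f + g|), and for f = T x, g = T x'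
    both |f - g| and |f + g| exceed d times the smaller of |x - x'|_r and
    |x + x'|_r on a common set of probability c.  Since the
    Lorentz functional is in general only a quasi-norm, closedness of the range
    is checked through convergence in probability.  This part is
    [series_range_copy_spr]; [lorentz_norm_upper] and [lorentz_norm_lower]
    translate between distribution functions and the Lorentz functional.

    Independence comes from a self-similar partition of (0,1): X is constant
    on each half of each interval of a partition, and sigma maps each such
    half affinely onto (0,1), so X is independent of sigma, which preserves
    the measure, and X_i = X o sigma^i.  All estimates are then inductions on
    the number of terms that peel off the first digit; no integral over (0,1)
    occurs in them.

    - For p < r < 2 let |X| = 2^(k/r) with probability 2^(-k-1), a discrete
      symmetric Pareto law.  The tail estimate comes from
      min((c+h)^2,1) + min((c-h)^2,1) <= 2 min(c^2,1) + 2 min(h^2,1) and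
      E min((aX)^2,1) <= C |a|^r.  Non-concentration: some term a_i X_i is
      likely to be of size at least 1 when |a|_r is large, and given this, its
      possible values are separated, so that a short interval catches at
      most one of them, of conditional probability at most 1/4
      ([heavy_small_ball]).
    - For r = 2 let X take the values 2, -2, 0 with probabilities 1/8, 1/8,
      3/4, so that E X^2 = 1 and E X^4 = 4.  The exponential moment
      E cosh(T x) <= exp(8 |x|^2) gives all tails.  Since E X^4 >= 3,
      E (T x)^2 (T x')^2 >= |x|^2 |x'|^2, and this correlation together with
      the tails prevents T x and T x' from being almost disjoint
      ([corr_bound_le_pr]). *)

(** * Probability on the unit interval *)

Section probability01.
Context {R : realType}.
Notation mu := (@lebesgue_measure R).
Implicit Types (A B : set R).

(** Real-valued, so that estimates are inequalities between reals; it is only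
    meaningful when the trace of [A] on (0,1) is measurable. *)
Definition pr A : R := fine (mu (I01 `&` A)).

Lemma measurable_I01 : measurable (@I01 R).
Proof. exact: measurable_itv. Qed.

Lemma mu_I01 : mu I01 = 1%E.
Proof.
by rewrite /I01 lebesgue_measure_itv/= lte_fin ltr01 -EFinB subr0.
Qed.

Lemma mu_I01_fin A : measurable (I01 `&` A) -> mu (I01 `&` A) \is a fin_num.
Proof.
move=> mA; rewrite ge0_fin_numE//; apply: (@le_lt_trans _ _ 1%E); last exact: ltry.
by rewrite -mu_I01; apply: le_measure; rewrite ?inE//; exact: measurable_I01.
Qed.

Lemma mu_prE A : measurable (I01 `&` A) -> mu (I01 `&` A) = (pr A)%:E.
Proof. by move=> mA; rewrite /pr fineK// mu_I01_fin. Qed.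

Lemma pr_ge0 A : 0 <= pr A.
Proof. by rewrite /pr fine_ge0. Qed.

Lemma le_pr A B : measurable (I01 `&` A) -> measurable (I01 `&` B) ->
  (forall t, I01 t -> A t -> B t) -> pr A <= pr B.
Proof.
move=> mA mB AB; rewrite -lee_fin -!mu_prE//.
by apply: le_measure; rewrite ?inE// => x [Ix Ax]; split => //; exact: AB.
Qed.

Lemma measurable_I01I A : measurable A -> measurable (I01 `&` A).
Proof. by move=> mA; apply: measurableI => //; exact: measurable_I01. Qed.

Lemma prT : pr setT = 1.
Proof. by rewrite /pr setIT mu_I01. Qed.

Lemma pr0 : pr set0 = 0.
Proof. by rewrite /pr setI0 measure0. Qed.

Lemma pr_le1 A : measurable (I01 `&` A) -> pr A <= 1.
Proof.
by move=> mA; rewrite -prT; apply: le_pr => //; rewrite setIT; exact: measurable_I01.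
Qed.

Lemma pr_union A B : measurable (I01 `&` A) -> measurable (I01 `&` B) ->
  pr (A `|` B) <= pr A + pr B.
Proof.
move=> mA mB; have mAB : measurable (I01 `&` (A `|` B)).
  by rewrite setIUr; exact: measurableU.
rewrite -lee_fin EFinD -!mu_prE// setIUr.
by apply: measureU2.
Qed.

Lemma pr_disjointU A B : measurable (I01 `&` A) -> measurable (I01 `&` B) ->
  (forall t, I01 t -> A t -> ~ B t) -> pr (A `|` B) = pr A + pr B.
Proof.
move=> mA mB AB; have mAB : measurable (I01 `&` (A `|` B)).
  by rewrite setIUr; exact: measurableU.
apply: EFin_inj; rewrite EFinD -!mu_prE// setIUr measureU//.
by apply/seteqP; split => // x [[Ix Ax] [_ Bx]]; exact: (AB x).
Qed.

Lemma pr_setC A : measurable (I01 `&` A) -> measurable (I01 `&` ~` A) ->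
  pr (~` A) = 1 - pr A.
Proof.
move=> mA mB; apply/eqP; rewrite eq_sym subr_eq addrC -pr_disjointU//.
  by rewrite setUv prT.
by move=> t _ At; exact.
Qed.

Lemma pr_bigcup_nondecreasing (B : nat -> set R) U :
  (forall n, measurable (B n)) -> (forall n, B n `<=` B n.+1) ->
  (forall n, pr (B n) <= U) -> pr (\bigcup_n B n) <= U.
Proof.
move=> mB BS BU.
have mI n : measurable (I01 `&` B n) by exact: measurable_I01I.
have mU : measurable (\bigcup_n B n) by exact: bigcup_measurable.
rewrite -lee_fin -mu_prE; last exact: measurable_I01I.
rewrite setI_bigcupr.
have := @nondecreasing_cvg_mu _ _ _ mu (fun n => I01 `&` B n) mI.
rewrite -setI_bigcupr => /(_ (measurable_I01I mU)) /=.
have nd : nondecreasing_seq (fun n => I01 `&` B n).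
  apply/nondecreasing_seqP => n; apply/subsetPset => x [Ix Bx].
  by split => //; exact: BS.
move=> /(_ nd) cv; rewrite -(cvg_lim _ cv)//.
apply: lime_le; first by apply/cvg_ex; eexists; exact: cv.
by apply: nearW => n /=; rewrite mu_prE// lee_fin.
Qed.

Lemma pr_bigU_disjoint (B : nat -> set R) n :
  (forall i, measurable (B i)) -> trivIset setT B ->
  pr (\big[setU/set0]_(i < n) B i) = \sum_(i < n) pr (B i).
Proof.
move=> mB tB; elim: n => [|n IH]; first by rewrite !big_ord0 pr0.
rewrite !big_ord_recr/= pr_disjointU ?IH//.
- by apply: measurable_I01I; exact: bigsetU_measurable.
- exact: measurable_I01I.
move=> t _; rewrite -bigcup_mkord => -[i /= ilt Bit] Bnt.
have := trivIsetP.1 tB i n I I; rewrite lt_eqF// => /(_ isT) E.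
by have : (B i `&` B n) t by []; rewrite E.
Qed.

(** Countable additivity along the partition into fibres of [K], in the form in
    which it serves to condition on the first digit: no series appears. *)
Lemma pr_partition_le (K : R -> nat) B U :
  (forall k, measurable (K @^-1` [set k])) -> measurable B ->
  (forall n, \sum_(k < n) pr (B `&` K @^-1` [set (k : nat)]) <= U) -> pr B <= U.
Proof.
move=> mK mB BU.
pose D k := B `&` K @^-1` [set k].
have mD k : measurable (D k) by exact: measurableI.
have tD : trivIset setT D.
  by apply/trivIsetP => i j _ _ ij; rewrite -subset0 => t [[_ /= Ki]] [_ /= Kj];
    rewrite -Ki -Kj eqxx in ij.
have -> : B = \bigcup_n (\big[setU/set0]_(i < n) D i).
  apply/seteqP; split=> [t Bt|t [n _]].
    exists (K t).+1 => //; rewrite -bigcup_mkord; exists (K t) => //=.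
  by rewrite -bigcup_mkord => -[k _ []].
apply: pr_bigcup_nondecreasing => [n|n|n].
- exact: bigsetU_measurable.
- by rewrite big_ord_recr/=; exact: subsetUl.
- by rewrite pr_bigU_disjoint.
Qed.

End probability01.

(** * Affine maps and the Bernoulli shift *)

Section affine.
Context {R : realType}.
Notation mu := (@lebesgue_measure R).

Lemma measurable_affine (l w : R) : measurable_fun setT (fun t : R => (t - l) / w).
Proof. by apply: measurable_funM => //; apply: measurable_funB. Qed.

(** The rescaled image measure agrees with Lebesgue measure on intervals. *)
Lemma lebesgue_measure_affine (l w : R) (A : set R) : 0 < w -> measurable A ->
  mu ((fun t => (t - l) / w) @^-1` A) = (w%:E * mu A)%E.
Proof.
move=> w0 mA.
pose phi := (fun t => (t - l) / w) : R -> measurableTypeR R.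
have mphi : measurable_fun setT phi by exact: measurable_affine.
have wi0 : 0 <= w^-1 by rewrite invr_ge0 ltW.
pose m := mscale (NngNum wi0)
  (measure_function_pushforward__canonical__measure_function_Measure mu mphi).
suff -> : mu A = m A.
  by rewrite /m /mscale/= muleA -EFinM mulfV ?gt_eqF// mul1e.
apply: lebesgue_measure_unique => //= _ [[a b]] _ <-.
have phiE : phi @^-1` `]a, b]%classic = `]l + w * a, l + w * b]%classic.
  apply/seteqP; split => t /=; rewrite !in_itv/= ltr_pdivlMr// ler_pdivrMr//;
    by rewrite ltrBrDl lerBlDl ![_ * w]mulrC.
rewrite /m /mscale /= /pushforward phiE !lebesgue_measure_itv/= !lte_fin ltrD2l ltr_pM2l//.
case: ifPn => _; last by rewrite mule0.
rewrite -!EFinB -EFinM; congr _%:E.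
by field; rewrite gt_eqF.
Qed.

(** Self-similarity of (0,1): conditionally on [l <= t < l + w], the point
    [(t - l) / w] is again uniformly distributed. *)
Lemma pr_affine (l w : R) (A : set R) : 0 <= l -> 0 <= w -> l + w <= 1 ->
  measurable A ->
  pr ([set t | l <= t < l + w] `&` ((fun t => (t - l) / w) @^-1` A)) = w * pr A.
Proof.
move=> l0 w0 lw1 mA.
(* Degenerate intervals occur in finite partitions; both sides then vanish. *)
have [->|wN0] := eqVneq w 0.
  rewrite mul0r addr0 [X in pr X](_ : _ = set0) ?pr0//.
  by rewrite -subset0 => t [/=]; lra.
have {wN0}w0 : 0 < w by rewrite lt_neqAle eq_sym wN0.
set phi := fun t => (t - l) / w.
set L := _ `&` _.
have mphiA (B : set R) : measurable B -> measurable (phi @^-1` B).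
  by move=> mB; rewrite -[X in measurable X]setTI; apply: measurable_affine.
have mIv : measurable ([set t : R | l <= t < l + w]).
  rewrite (_ : [set t | _] = `[l, l + w[%classic) ?measurable_itv//.
have mL : measurable (I01 `&` L).
  by apply: measurable_I01I; apply: measurableI => //; exact: mphiA.
pose D := phi @^-1` (I01 `&` A).
have mD : measurable D by apply: mphiA; exact: measurable_I01I.
have muD : mu D = (w * pr A)%:E.
  by rewrite lebesgue_measure_affine//; [rewrite mu_prE// -?EFinM//|]; exact: measurable_I01I.
(* [L] and the preimage of the open interval differ at most by the point [l]. *)
apply: EFin_inj; rewrite -mu_prE// -muD; apply/eqP; rewrite eq_le; apply/andP; split.
- apply: (@le_trans _ _ (mu (D `|` [set l]))).
    apply: le_measure; rewrite ?inE//; first exact: measurableU.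
    move=> t [It [/= lt At]]; have [->|tl] := eqVneq t l; [by right|left].
    split => //; rewrite /I01/= in_itv/= /phi ltr_pdivlMr// ltr_pdivrMr// mul0r mul1r.
    by move/andP: lt => [lt1 lt2]; rewrite subr_gt0 ltrBlDl lt2 andbT lt_neqAle eq_sym tl.
  apply: (le_trans (measureU2 _ _ _)) => //.
  by rewrite /= lebesgue_measure_set1 adde0.
- apply: le_measure; rewrite ?inE// => t [].
  rewrite /I01/= !in_itv/= /phi ltr_pdivlMr// ltr_pdivrMr// mul0r mul1r => /andP[t1 t2] At.
  by split; [|split => //=]; lra.
Qed.

End affine.

Section dyadic.
Context {R : realType}.

Definition dyadic (k : nat) : R := 2^-1 ^+ k.

Lemma dyadic_gt0 k : 0 < dyadic k. Proof. by rewrite exprn_gt0. Qed.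

Lemma dyadic_half k : dyadic k.+1 = dyadic k / 2.
Proof. by rewrite /dyadic exprSr. Qed.

Lemma dyadic_nonincreasing k : dyadic k.+1 <= dyadic k.
Proof. by rewrite dyadic_half; have := dyadic_gt0 k; lra. Qed.

Lemma dyadic_small (t : R) : 0 < t -> exists k, dyadic k <= t.
Proof.
move=> t0; have [k _ kt] := near_infty_natSinv_expn_lt (PosNum t0).
by exists k; apply/ltW; have := kt k (leqnn _); rewrite /= div1r -exprVn.
Qed.

End dyadic.

Section bernoulli_scheme.
Context {R : realType}.
Variables (c y : nat -> R).
Hypothesis c0 : c 0%N = 1.
Hypothesis cS : forall k, c k.+1 <= c k.
Hypothesis c_ge0 : forall k, 0 <= c k.
Hypothesis c_inf : forall t : R, 0 < t -> exists k, c k <= t.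

(** The interval [c (k+1), c k[ is cut into halves of length [weight k]; the
    lower half carries the value [- y k], the upper one the value [y k]. *)
Definition weight k := (c k - c k.+1) / 2.

(** The index of the interval containing [t]; it is total, with value 0 at the
    points below all [c k], so that the maps built on it are measurable on the
    whole line. *)
Definition level (t : R) : nat :=
  if pselect (exists k, c k.+1 <= t) is left h then ex_minn h else 0%N.

Definition upper t := c (level t).+1 + weight (level t) <= t.

Definition shift t :=
  (t - (if upper t then c (level t).+1 + weight (level t) else c (level t).+1)) /
    weight (level t).

Definition digit t := if upper t then y (level t) else - y (level t).

Lemma weight_ge0 k : 0 <= weight k.
Proof. by rewrite /weight divr_ge0// subr_ge0. Qed.

Lemma levelP t k : I01 t -> (level t = k) <-> (c k.+1 <= t < c k).
Proof.
rewrite /I01/= in_itv/= => /andP[t0 t1].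
have cle i j : (i <= j)%N -> c j <= c i.
  by move=> /subnKC <-; elim: (j - i)%N => [|n IH]; rewrite ?addn0// addnS (le_trans (cS _)).
have ex : exists k, c k.+1 <= t.
  by have [i ci] := c_inf t0; exists i; rewrite (le_trans (cS _)).
rewrite /level; case: pselect => // h; case: ex_minnP => m cm mmin.
have tm : t < c m.
  by case: m cm mmin => [|m] cm mmin; [rewrite c0|rewrite ltNge; apply/negP => /mmin; rewrite ltnn].
split=> [<-|/andP[k1 k2]]; first by rewrite cm.
apply/eqP; rewrite eqn_leq mmin//= leqNgt; apply/negP => mk.
by have := cle _ _ mk; lra.
Qed.

Lemma measurable_levelS k : measurable (level @^-1` [set k.+1]).
Proof.
rewrite (_ : _ @^-1` _ = `[c k.+2, +oo[%classic `&`
    \bigcap_(j in [set j | (j <= k)%N]) `]-oo, c j.+1[%classic).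
  apply: measurableI; first exact: measurable_itv.
  by apply: bigcap_measurable => [|j _]; [exists 0%N|exact: measurable_itv].
apply/seteqP; split => t /=.
  rewrite /level; case: pselect => // h; case: ex_minnP => m cm mmin mk.
  rewrite in_itv/= andbT -mk cm; split => // j /= jk.
  rewrite in_itv/= ltNge; apply/negP => /mmin; rewrite mk.
  by rewrite ltnNge jk.
rewrite in_itv/= andbT => -[ck cj].
rewrite /level; case: pselect => [h|]; last by move=> h; exfalso; apply: h; exists k.+1.
case: ex_minnP => m cm mmin; apply/eqP; rewrite eqn_leq mmin//= leqNgt; apply/negP.
by rewrite ltnS => /cj; rewrite /= in_itv/= ltNge cm.
Qed.

Lemma measurable_level k : measurable (level @^-1` [set k]).
Proof.
case: k => [|k]; last exact: measurable_levelS.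
rewrite (_ : _ @^-1` _ = ~` \bigcup_k (level @^-1` [set k.+1])).
  by apply: measurableC; apply: bigcup_measurable => k _; exact: measurable_levelS.
apply/seteqP; split => t /=; first by move=> t0 [k _] /=; rewrite t0.
case E : (level t) => [//|k] h; exfalso; apply: h; exists k => //.
Qed.

Lemma measurable_by_level (f : nat -> R -> R) :
  (forall k, measurable_fun setT (f k)) -> measurable_fun setT (fun t => f (level t) t).
Proof.
move=> mf _ A mA; rewrite setTI.
rewrite (_ : _ @^-1` _ = \bigcup_k (level @^-1` [set k] `&` f k @^-1` A)).
  apply: bigcup_measurable => k _; apply: measurableI; first exact: measurable_level.
  by rewrite -[X in measurable X]setTI; exact: mf.
apply/seteqP; split => t /=; first by move=> At; exists (level t).
by move=> [k _ [/= ->]].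
Qed.

Lemma measurable_shift : measurable_fun setT shift.
Proof.
apply: (@measurable_by_level (fun k t =>
  (t - (if c k.+1 + weight k <= t then c k.+1 + weight k else c k.+1)) / weight k)) => k.
apply: measurable_funM => //; apply: measurable_funB => //.
apply: measurable_fun_ifT => //; exact: measurable_fun_ler.
Qed.

Lemma measurable_digit : measurable_fun setT digit.
Proof.
apply: (@measurable_by_level (fun k t =>
  if c k.+1 + weight k <= t then y k else - y k)) => k.
apply: measurable_fun_ifT => //; exact: measurable_fun_ler.
Qed.

(** Independence of the digit and the shift: on each half of the interval number
    [k] the shift is affine onto the unit interval. *)
Lemma pr_level (A Ap Am : set R) k : measurable A -> measurable Ap -> measurable Am ->
  (forall t, level t = k -> upper t -> A t <-> Ap (shift t)) ->
  (forall t, level t = k -> ~~ upper t -> A t <-> Am (shift t)) ->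
  pr (A `&` level @^-1` [set k]) = weight k * (pr Ap + pr Am).
Proof.
move=> mA mAp mAm hp hm.
have c1 : c k <= 1.
  by elim: k {hp hm} => [|k IH]; [rewrite c0|exact: le_trans IH].
have w0 := weight_ge0 k.
have cw : c k.+1 + weight k + weight k = c k by rewrite /weight; field.
pose P1 := [set t | c k.+1 <= t < c k.+1 + weight k] `&`
  ((fun t => (t - c k.+1) / weight k) @^-1` Am).
pose P2 := [set t | c k.+1 + weight k <= t < c k.+1 + weight k + weight k] `&`
  ((fun t => (t - (c k.+1 + weight k)) / weight k) @^-1` Ap).
have mP (l : R) (B : set R) : measurable B ->
   measurable (I01 `&` ([set t | l <= t < l + weight k] `&`
     ((fun t => (t - l) / weight k) @^-1` B))).
  move=> mB; apply: measurable_I01I; apply: measurableI.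
    rewrite (_ : [set t | _] = `[l, l + weight k[%classic) ?measurable_itv//.
  by rewrite -[X in measurable X]setTI; apply: measurable_affine.
have mAl : measurable (I01 `&` (A `&` level @^-1` [set k])).
  by apply: measurable_I01I; apply: measurableI => //; exact: measurable_level.
have -> : pr (A `&` level @^-1` [set k]) = pr (P1 `|` P2).
  apply/eqP; rewrite eq_le; apply/andP; split; apply: le_pr => //.
  - by rewrite setIUr; apply: measurableU; exact: mP.
  - move=> t It [At /= tk]; have /(levelP _ It) /andP[t1 t2] := tk.
    have [ut|ut] := boolP (upper t); [right|left].
      have := (hp _ tk ut).1 At; rewrite /P2 /shift ut tk => ?; split => //=.
      by move: ut; rewrite /upper tk cw => -> /=.
    have := (hm _ tk ut).1 At; rewrite /P1 /shift (negbTE ut) tk => ?; split => //=.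
    by move: ut; rewrite /upper tk -ltNge t1 => ->.
  - by rewrite setIUr; apply: measurableU; exact: mP.
  - move=> t It [[/= /andP[t1 t2] Ht]|[/= /andP[t1 t2] Ht]].
      have tk : level t = k by apply/levelP => //; rewrite t1/=; lra.
      have ut : ~~ upper t by rewrite /upper tk -ltNge.
      by split => //; apply: (hm _ tk ut).2; rewrite /shift (negbTE ut) tk.
    have tk : level t = k by apply/levelP => //; lra.
    have ut : upper t by rewrite /upper tk.
    by split => //; apply: (hp _ tk ut).2; rewrite /shift ut tk.
rewrite pr_disjointU; [|exact: mP|exact: mP|]; last first.
  by move=> t _ [/= /andP[_ t1] _] [/= /andP[t2 _] _]; lra.
have ck1 := c_ge0 k.+1.
rewrite !pr_affine//; [by rewrite mulrDr addrC|lra|lra|lra].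
Qed.

End bernoulli_scheme.

Section scheme.
Context {R : realType}.

(** What the estimates need from the shift: [X] takes the values [y k] and [- y k]
    with probability [v k] each, independently of [sigma].  Independence is
    [scheme_fiber], stated for events [A] that are functions of [X] and [sigma]
    and restricted to the index [K = k]. *)
Record symmetric_scheme (X sigma : R -> R) (K : R -> nat) (v y : nat -> R) : Prop := {
  scheme_value_measurable : measurable_fun setT X ;
  scheme_shift_measurable : measurable_fun setT sigma ;
  scheme_index_measurable : forall k, measurable (K @^-1` [set k]) ;
  scheme_weight_ge0 : forall k, 0 <= v k ;
  scheme_weight_sum : forall n, \sum_(k < n) 2 * v k <= 1 ;
  scheme_fiber : forall (A : set R) (F : R -> set R) k,
    measurable A -> (forall x, measurable (F x)) ->
    (forall t, A t <-> F (X t) (sigma t)) ->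
    pr (A `&` K @^-1` [set k]) = v k * (pr (F (y k)) + pr (F (- y k))) }.

Lemma bernoulli_symmetric_scheme (c y : nat -> R) :
  c 0%N = 1 -> (forall k, c k.+1 <= c k) -> (forall k, 0 <= c k) ->
  (forall t : R, 0 < t -> exists k, c k <= t) ->
  symmetric_scheme (digit c y) (shift c) (level c) (weight c) y.
Proof.
move=> c0 cS c_ge0 c_inf; split.
- exact: measurable_digit.
- exact: measurable_shift.
- exact: measurable_level.
- exact: weight_ge0.
- move=> n; apply: (@le_trans _ _ (c 0%N - c n)).
    elim: n => [|n IH]; first by rewrite big_ord0 subrr.
    by rewrite big_ord_recr/=; apply: (le_trans (lerD IH (lexx _))); rewrite /weight; lra.
  by rewrite c0; have := c_ge0 n; lra.
move=> A F k mA mF AF; apply: pr_level => // t tk ut; rewrite AF /digit tk.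
  by rewrite ut.
by rewrite (negbTE ut).
Qed.

End scheme.

(** * Random walks with symmetric independent steps *)

Section walk.
Context {R : realType}.
Variables (X sigma : R -> R) (K : R -> nat) (v y : nat -> R).
Hypothesis sch : symmetric_scheme X sigma K v y.
Implicit Types (a b : nat -> R) (A : set R).

(** The partial sum of the terms [a i * X (sigma^i t)], [i < n], in the form that
    exposes the first step. *)
Fixpoint walk n a t : R :=
  if n is n'.+1 then a 0%N * X t + walk n' (fun i => a i.+1) (sigma t) else 0.

Lemma measurable_walk n a : measurable_fun setT (walk n a).
Proof.
elim: n a => [|n IH] a /=; first exact: measurable_cst.
apply: measurable_funD.
  by apply: measurable_funM => //; exact: scheme_value_measurable sch.
by apply: (@measurableT_comp _ _ _ _ _ _ (walk n _)) => //; exact: scheme_shift_measurable sch.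
Qed.

Lemma walk_linear n l a b t :
  walk n (fun i => l * a i + b i) t = l * walk n a t + walk n b t.
Proof.
elim: n a b t => [|n IH] a b t /=; first by rewrite mulr0 addr0.
by rewrite IH; ring.
Qed.

Lemma walk_cat N n a t :
  walk (N + n) a t = walk N a t + walk n (fun i => a (N + i)%N) (iter N sigma t).
Proof.
elim: N a t => [|N IH] a t; first by rewrite add0r.
by rewrite addSn [LHS]/= IH /= -iterS iterSr addrA.
Qed.

Lemma pr_shift A : measurable A -> pr (sigma @^-1` A) <= pr A.
Proof.
move=> mA; have mS : measurable (sigma @^-1` A).
  by rewrite -[X in measurable X]setTI; apply: scheme_shift_measurable sch _ _ _.
apply: (@pr_partition_le _ K) => //; first exact: scheme_index_measurable sch.
move=> n; apply: (@le_trans _ _ ((\sum_(k < n) 2 * v k) * pr A)).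
  rewrite mulr_suml; apply: ler_sum => k _.
  by rewrite (scheme_fiber (F := fun=> A) sch)//; lra.
by rewrite ler_piMl ?pr_ge0//; exact: scheme_weight_sum sch _.
Qed.

Lemma measurable_iter_shift N : measurable_fun setT (iter N sigma).
Proof.
elim: N => [|N IH]; first exact: measurable_id.
by apply: (@measurableT_comp _ _ _ _ _ _ sigma) => //; exact: scheme_shift_measurable sch.
Qed.

Lemma pr_iter_shift N A : measurable A -> pr (iter N sigma @^-1` A) <= pr A.
Proof.
elim: N A => [|N IH] A mA; first exact: lexx.
apply: le_trans (pr_shift mA); apply: (IH (sigma @^-1` A)).
by rewrite -[X in measurable X]setTI; apply: scheme_shift_measurable sch _ _ _.
Qed.

Definition exit_event n a x s := [set t | exists2 k, (k <= n)%N & s <= `|x + walk k a t|].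

Lemma measurable_exit_event n a x s : measurable (exit_event n a x s).
Proof.
have -> : exit_event n a x s =
    \bigcup_(k in [set k | (k <= n)%N]) [set t | s <= `|x + walk k a t|].
  by apply/seteqP; split => t [k kn ?]; exists k.
apply: bigcup_measurable => k _; rewrite -[X in measurable X]setTI.
apply: (@measurable_fun_ler _ _ _ _ (cst s) (fun t => `|x + walk k a t|)) => //.
by apply: measurableT_comp => //; apply: measurable_funD => //; exact: measurable_walk.
Qed.

(** A maximal inequality: any nonnegative function of the starting point that is
    at least 1 outside the interval and decreases in mean along the walk
    dominates the exit probability.  The maximum over time costs nothing, since
    the induction stops as soon as the walk is outside. *)
Lemma pr_exit_le (U : nat -> (nat -> R) -> R -> R) s :
  (forall n a x, 0 <= U n a x) ->
  (forall n a x, s <= `|x| -> 1 <= U n a x) ->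
  (forall n a x N, \sum_(k < N) v k * (U n (fun i => a i.+1) (x + a 0%N * y k) +
      U n (fun i => a i.+1) (x - a 0%N * y k)) <= U n.+1 a x) ->
  forall n a x, pr (exit_event n a x s) <= U n a x.
Proof.
move=> U0 U1 US.
have prle1 n a x : pr (exit_event n a x s) <= 1.
  by apply: pr_le1; apply: measurable_I01I; exact: measurable_exit_event.
elim=> [|n IH] a x.
  have [sx|xs] := leP s `|x|; first exact: le_trans (prle1 _ _ _) (U1 _ _ _ sx).
  rewrite (_ : exit_event _ _ _ _ = set0) ?pr0//.
  by rewrite -subset0 => t [k]; rewrite leqn0 => /eqP -> /=; rewrite addr0 leNgt xs.
have [sx|xs] := leP s `|x|; first exact: le_trans (prle1 _ _ _) (U1 _ _ _ sx).
apply: (pr_partition_le (K := K)).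
- exact: scheme_index_measurable sch.
- exact: measurable_exit_event.
move=> N; apply: le_trans (US n a x N).
apply: ler_sum => k _.
rewrite (scheme_fiber (F := fun z => exit_event n (fun i => a i.+1) (x + a 0%N * z) s) sch).
- by rewrite ler_wpM2l ?(scheme_weight_ge0 sch)// mulrN lerD.
- exact: measurable_exit_event.
- by move=> z; exact: measurable_exit_event.
move=> t; split => [[[|j] jn /=]|[j jn sj]].
- by rewrite addr0 leNgt xs.
- by rewrite addrA => sj; exists j.
- by exists j.+1 => //=; rewrite addrA.
Qed.

End walk.

(** * Lorentz quasi-norms and tails *)

Section lorentz_estimates.
Context {R : realType}.
Notation mu := (@lebesgue_measure R).
Implicit Types (f : R -> R) (p s t : R) (q : \bar R).

(** Monotonicity without measurability of the integrands, because the integral of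
    a nonnegative function is a supremum over simple functions below it.  It
    is applied to integrands built from rearrangements. *)
Lemma le_integral_ge0 (D : set R) (f g : R -> \bar R) :
  (forall x, D x -> (0 <= f x)%E) -> (forall x, D x -> (f x <= g x)%E) ->
  (\int[mu]_(x in D) f x <= \int[mu]_(x in D) g x)%E.
Proof.
move=> f0 fg; rewrite !ge0_integralE//; last first.
  by move=> x Dx; exact: le_trans (f0 x Dx) (fg x Dx).
apply: ge_ereal_sup => _ [h hf <-]; apply: ereal_sup_ubound => /=; exists h => // x.
apply: le_trans (hf x) _; rewrite /patch; case: ifPn => //.
by rewrite inE; exact: fg.
Qed.

Lemma powR_sub1 t (g : R) : 0 < t -> t `^ (g - 1) = t `^ g * t^-1.
Proof.
move=> t0; rewrite powRD; first by rewrite powR_inv1 ?ltW.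
by rewrite (gt_eqF t0) implybT.
Qed.

(** On the dyadic interval number [k] the integrand is at most
    [2^(k+1) 2^(-kg)], so the integral is bounded by a geometric series. *)
Lemma integral_powR_lty (g : R) : 0 < g ->
  exists2 J : R, 0 <= J & (\int[mu]_(t in I01) (t `^ g * t^-1)%:E <= J%:E)%E.
Proof.
move=> g0.
pose c := @dyadic R.
have c0 : c 0%N = 1 by rewrite /c /dyadic expr0.
have cS k : c k.+1 = c k / 2 by exact: dyadic_half.
have cgt0 k : 0 < c k by exact: dyadic_gt0.
have cle k : c k.+1 <= c k by exact: dyadic_nonincreasing.
have c_inf t : 0 < t -> exists k, c k <= t by exact: dyadic_small.
pose lev := level c.
pose F k := I01 `&` lev @^-1` [set k].
have mF k : measurable (F k).
  by apply: measurable_I01I; exact: measurable_level.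
have FU : I01 = \bigcup_k F k.
  by apply/seteqP; split=> [t It|t [k _ []]//]; exists (lev t).
have tF : trivIset setT F.
  by apply/trivIsetP => i j _ _ ij; rewrite -subset0 => t [[_ /= Ki]] [_ /= Kj];
    rewrite -Ki -Kj eqxx in ij.
pose th := 2^-1 `^ g.
have th0 : 0 < th by rewrite powR_gt0.
have th1 : th < 1.
  have <- : 1 `^ g = 1 :> R by rewrite powR1.
  by apply: gt0_ltr_powR; rewrite ?nnegrE//; lra.
exists (1 - th)^-1; first by rewrite invr_ge0; lra.
apply: (@le_trans _ _ (\int[mu]_(t in I01) (t `^ (g - 1))%:E)%E).
  apply: le_integral_ge0 => t; rewrite /I01/= in_itv/= => /andP[t0 t1].
    by rewrite lee_fin mulr_ge0 ?powR_ge0// invr_ge0 ltW.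
  by rewrite powR_sub1.
rewrite FU ge0_integral_bigcup//; last 2 first.
- apply/measurable_EFinP; apply: measurable_funTS; exact: measurable_powR.
- by move=> t _; rewrite lee_fin powR_ge0.
apply: lime_le.
  apply: is_cvg_ereal_nneg_natsum => k _; apply: integral_ge0 => t _.
  by rewrite lee_fin powR_ge0.
apply: nearW => n.
apply: (@le_trans _ _ (\sum_(0 <= k < n) (th ^+ k)%:E)%E).
  apply: lee_sum => k _.
  apply: (@le_trans _ _ (\int[mu]_(t in F k) (cst ((c k `^ g / c k.+1)%:E) t))%E).
    apply: le_integral_ge0 => t; first by move=> _; rewrite lee_fin powR_ge0.
    move=> [It /= /levelP]; rewrite c0 => /(_ erefl cle c_inf It) /andP[t1 t2].
    have t0 : 0 < t by rewrite (lt_le_trans (cgt0 k.+1)).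
    rewrite lee_fin powR_sub1//.
    apply: ler_pM; [exact: powR_ge0|by rewrite invr_ge0 ltW| |].
      by apply: ge0_ler_powR; rewrite ?nnegrE ltW.
    by rewrite lef_pV2// posrE.
  rewrite integral_cst; last exact: mF.
  have muF : (mu (F k) <= (c k - c k.+1)%:E)%E.
    apply: (@le_trans _ _ (mu `[c k.+1, c k[%classic)).
      apply: le_measure; rewrite ?inE; [exact: mF|exact: measurable_itv|].
      move=> t [It /= /levelP].
      by rewrite c0 => /(_ erefl cle c_inf It); rewrite in_itv.
    by rewrite lebesgue_measure_itv/= lte_fin; case: ifPn => //; rewrite lee_fin subr_ge0.
  apply: (@le_trans _ _ ((c k `^ g / c k.+1)%:E * (c k - c k.+1)%:E)%E).
    by apply: lee_wpmul2l => //; rewrite lee_fin divr_ge0 ?powR_ge0// ltW.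
  rewrite -EFinM lee_fin.
  have -> : c k - c k.+1 = c k.+1 by rewrite cS; field.
  rewrite -mulrA mulVf ?gt_eqF// mulr1.
  by rewrite /c /dyadic /th -powR_mulrn ?invr_ge0// -powRrM mulrC powRrM powR_mulrn ?powR_ge0.
rewrite sumEFin lee_fin big_mkord.
have geo := subrX1 th n; have thn : 0 <= th ^+ n by rewrite exprn_ge0 ?ltW.
by rewrite -[leRHS]mul1r ler_pdivlMr ?subr_gt0//; lra.
Qed.

Lemma measurable_distribution f s : measurable_fun I01 f ->
  measurable (I01 `&` [set x | s < `|f x|]).
Proof.
move=> mf.
have := @measurable_fun_ltr _ _ _ I01 (cst s) (fun x => `|f x|).
move=> /(_ _ _ measurable_I01 [set true]); apply => //.
by apply: measurableT_comp.
Qed.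

Lemma distributionE f s : measurable_fun I01 f ->
  distribution01 f s = (pr [set x | s < `|f x|])%:E.
Proof. by move=> mf; rewrite -mu_prE//; exact: measurable_distribution. Qed.

Lemma rearrangement_ge f s t : measurable_fun I01 f -> 0 <= s ->
  t < pr [set x | s < `|f x|] -> (s%:E <= rearrangement f t)%E.
Proof.
move=> mf s0 tpr; apply: le_ereal_inf_tmp => _ [u [u0 du] <-]; rewrite lee_fin leNgt.
apply/negP => us; move: du; rewrite distributionE// lee_fin => du.
have : pr [set x | s < `|f x|] <= pr [set x | u < `|f x|].
  apply: le_pr; try exact: measurable_distribution.
  by move=> x _ /=; exact: lt_trans.
by move=> /le_trans/(_ du); rewrite leNgt tpr.
Qed.

Lemma rearrangement_ge0 f t : (0 <= rearrangement f t)%E.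
Proof. by apply: le_ereal_inf_tmp => _ [u [u0 _] <-]; rewrite lee_fin. Qed.

Lemma lorentz_norm_ge0 p q f : 1 <= p -> (1 <= q)%E -> (0 <= lorentz_norm p q f)%E.
Proof.
move=> p1; case: q => [q||]//= q1.
  exact: poweR_ge0.
apply: (@le_trans _ _ (((1/2) `^ p^-1)%:E * rearrangement f (1/2))%E).
  by rewrite mule_ge0 ?rearrangement_ge0// lee_fin powR_ge0.
apply: ereal_sup_ubound; exists (1/2) => //.
by rewrite /I01/= in_itv/=; lra.
Qed.

(** If |f| exceeds [s] with probability [c], its rearrangement exceeds [s] on
    ]0, c[; restricting the functional to a compact part of that interval is
    enough. *)
Lemma lorentz_norm_lower p q (c : R) : 1 <= p -> (1 <= q)%E -> 0 < c -> c <= 1 ->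
  exists2 k : R, 0 < k & forall f s, measurable_fun I01 f -> 0 <= s ->
    c <= pr [set x | s < `|f x|] -> ((k * s)%:E <= lorentz_norm p q f)%E.
Proof.
move=> p1 q1 c0 c1; have p0 : 0 < p by lra.
case: q q1 => [q||]//= q1; last first.
  exists ((c / 2) `^ p^-1); first by rewrite powR_gt0//; lra.
  move=> f s mf s0 cpr.
  apply: (@le_trans _ _ (((c / 2) `^ p^-1)%:E * rearrangement f (c / 2))%E).
    rewrite EFinM; apply: lee_wpmul2l; first by rewrite lee_fin powR_ge0.
    by apply: rearrangement_ge => //; lra.
  apply: ereal_sup_ubound; exists (c / 2) => //.
  by rewrite /I01/= in_itv/=; lra.
rewrite lee_fin in q1; have q0 : 0 < q by lra.
pose D := `]c / 4, c / 2[%classic : set R.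
have mD : measurable D by exact: measurable_itv.
have DI : D `<=` I01 by move=> t; rewrite /D /I01 /= !in_itv/=; lra.
have muD : mu D = (c / 4)%:E.
  rewrite lebesgue_measure_itv/= lte_fin ifT; last by lra.
  by rewrite -EFinB; congr (_%:E); field.
pose k0 := (c / 4) `^ p^-1.
have k00 : 0 < k0 by rewrite powR_gt0//; lra.
exists (((q / p) * (c / 4)) `^ q^-1 * k0).
  by rewrite mulr_gt0// powR_gt0// mulr_gt0// divr_gt0//; lra.
move=> f s mf s0 cpr.
have qp0 : 0 <= q / p by rewrite divr_ge0 ?ltW.
have step : (((k0 * s) `^ q * (c / 4))%:E <=
  \int[mu]_(t in I01) (((t `^ p^-1)%:E * rearrangement f t) `^ q * (t^-1)%:E))%E.
  apply: (@le_trans _ _ (\int[mu]_(t in I01) (((k0 * s) `^ q)%:E * (\1_D t)%:E))%E).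
    rewrite ge0_integralZl_EFin ?powR_ge0//; last first.
    - by apply/measurable_EFinP; exact: measurable_indic.
    - exact: measurable_I01.
    rewrite integral_indic ?setIidl//.
      by rewrite [X in (_ * X)%E]muD EFinM.
    exact: measurable_I01.
  apply: le_integral_ge0 => t; first by rewrite mule_ge0// lee_fin// powR_ge0.
  rewrite /I01/= in_itv/= => /andP[t0 t1].
  rewrite indicE; have [|_] := boolP (t \in D); last first.
    by rewrite mule0 mule_ge0 ?poweR_ge0// lee_fin invr_ge0 ltW.
  rewrite inE /D/= in_itv/= => /andP[t2 t3].
  apply: lee_pmul; rewrite ?lee_fin ?powR_ge0//; last by rewrite invf_ge1// ltW.
  rewrite -poweR_EFin; apply: gt0_ler_poweR; first exact: ltW.
  - by rewrite in_itv/= lee_fin leey mulr_ge0// ltW.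
  - by rewrite in_itv/= leey mule_ge0 ?rearrangement_ge0// lee_fin powR_ge0.
  rewrite EFinM; apply: lee_pmul; rewrite ?lee_fin ?(ltW k00)//.
    by apply: ge0_ler_powR; rewrite ?nnegrE ?invr_ge0; lra.
  by apply: rearrangement_ge => //; lra.
apply: (@le_trans _ _ (((q / p)%:E * ((k0 * s) `^ q * (c / 4))%:E) `^ q^-1)%E); last first.
  apply: gt0_ler_poweR.
  - by rewrite invr_ge0 ltW.
  - rewrite in_itv/= leey andbT -EFinM lee_fin; apply: mulr_ge0 => //.
    by apply: mulr_ge0; [exact: powR_ge0|lra].
  - rewrite in_itv/= leey andbT mule_ge0// integral_ge0// => t.
    rewrite /I01/= in_itv/= => /andP[t0 _].
    by rewrite mule_ge0 ?poweR_ge0// lee_fin invr_ge0 ltW.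
  - by apply: lee_wpmul2l => //; rewrite lee_fin.
rewrite -EFinM poweR_EFin lee_fin.
have qc0 : 0 <= q / p * (c / 4) by apply: mulr_ge0 => //; lra.
rewrite [X in _ <= X `^ _](_ : _ = (q / p * (c / 4)) * (k0 * s) `^ q); last by ring.
rewrite [leRHS]powRM ?powR_ge0//.
by rewrite -powRrM mulfV ?gt_eqF// powRr1 ?mulrA// mulr_ge0// ltW.
Qed.

Lemma rearrangement_le f s t : 0 <= s -> (distribution01 f s <= t%:E)%E ->
  (rearrangement f t <= s%:E)%E.
Proof. by move=> s0 ds; apply: ereal_inf_lbound; exists s. Qed.

(** Inverting the tail bound gives a rearrangement of order [t^(-1/m)], and
    [1/p - 1/m > 0] makes the functional finite. *)
Lemma lorentz_norm_upper p q (m C : R) : 1 <= p -> (1 <= q)%E -> p < m -> 0 < C ->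
  exists2 k : R, 0 <= k & forall f (A : R), 0 <= A ->
    (forall s, 0 < s -> (distribution01 f s <= (C * (A / s) `^ m)%:E)%E) ->
    (lorentz_norm p q f <= (k * A)%:E)%E.
Proof.
move=> p1 q1 pm C0; have p0 : 0 < p by lra.
have m0 : 0 < m by lra.
(* The case [A = 0] follows by letting [A] tend to 0. *)
suff [k k0 hk] : exists2 k : R, 0 <= k & forall f (A : R), 0 < A ->
    (forall s, 0 < s -> (distribution01 f s <= (C * (A / s) `^ m)%:E)%E) ->
    (lorentz_norm p q f <= (k * A)%:E)%E.
  exists k => // f A A0 df; apply/lee_addgt0Pr => e e0.
  have kp : 0 < k + 1 by lra.
  have e1 : 0 < e / (k + 1) by rewrite divr_gt0.
  apply: (@le_trans _ _ (k * (A + e / (k + 1)))%:E).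
    apply: hk; first by rewrite ltr_wpDl.
    move=> s s0; apply: le_trans (df s s0) _; rewrite lee_fin ler_wpM2l ?(ltW C0)//.
    apply: ge0_ler_powR; rewrite ?nnegrE ?divr_ge0// ?(ltW m0) ?(ltW s0)//; first by lra.
    by rewrite ler_wpM2r ?invr_ge0 ?(ltW s0)//; lra.
  rewrite -EFinD lee_fin mulrDr lerD2l mulrCA ger_pMr// ler_pdivrMr//; lra.
have im0 : 0 < m^-1 by rewrite invr_gt0.
pose b := p^-1 - m^-1.
have b0 : 0 < b by rewrite subr_gt0 ltf_pV2 ?posrE.
pose C1 := C `^ m^-1.
have C10 : 0 <= C1 by exact: powR_ge0.
have est f (A : R) : 0 < A ->
    (forall s, 0 < s -> (distribution01 f s <= (C * (A / s) `^ m)%:E)%E) ->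
    forall t, 0 < t -> ((t `^ p^-1)%:E * rearrangement f t <= (C1 * A * t `^ b)%:E)%E.
  move=> A0 df t t0; pose s := C1 * t `^ (- m^-1) * A.
  have s0 : 0 < s by rewrite /s !mulr_gt0 ?powR_gt0.
  have ft : (rearrangement f t <= s%:E)%E.
    apply: rearrangement_le; first exact: ltW.
    apply: le_trans (df s s0) _; rewrite lee_fin.
    have -> : A / s = C `^ (- m^-1) * t `^ (m^-1).
      rewrite /s !powRN /C1; field.
      by rewrite !gt_eqF ?powR_gt0.
    rewrite powRM ?powR_ge0// -!powRrM mulNr mulVf ?gt_eqF// powR_inv1
      ?powRr1 ?(ltW t0) ?(ltW C0)//.
    by rewrite mulrA mulfV ?gt_eqF// mul1r.
  apply: (@le_trans _ _ ((t `^ p^-1)%:E * s%:E)%E).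
    by apply: lee_wpmul2l => //; rewrite lee_fin powR_ge0.
  rewrite -EFinM lee_fin /s /b powRD; last by rewrite (gt_eqF t0) implybT.
  by rewrite le_eqVlt; apply/orP; left; apply/eqP; ring.
case: q q1 => [q||]//= q1; last first.
  exists C1 => // f A A0 df; apply: ge_ereal_sup => _ [t + <-].
  rewrite /I01/= in_itv/= => /andP[t0 t1].
  apply: le_trans (est f A A0 df t t0) _; rewrite lee_fin ler_piMr ?mulr_ge0 ?(ltW A0)//.
  have <- : 1 `^ b = 1 :> R by rewrite powR1.
  by apply: ge0_ler_powR; rewrite ?nnegrE ?ltW.
rewrite lee_fin in q1; have q0 : 0 < q by lra.
have bq0 : 0 < b * q by rewrite mulr_gt0.
have [J J0 HJ] := integral_powR_lty bq0.
have qp0 : 0 <= q / p by rewrite divr_ge0 ?ltW.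
exists (C1 * ((q / p) * J) `^ q^-1); first by rewrite mulr_ge0 ?powR_ge0.
move=> f A A0 df.
have int_le : (\int[mu]_(t in I01) (((t `^ p^-1)%:E * rearrangement f t) `^ q * (t^-1)%:E) <=
   ((C1 * A) `^ q * J)%:E)%E.
  apply: (@le_trans _ _ (\int[mu]_(t in I01) (((C1 * A) `^ q)%:E * (t `^ (b * q) * t^-1)%:E))%E).
    apply: le_integral_ge0 => t; rewrite /I01/= in_itv/= => /andP[t0 t1].
      by rewrite mule_ge0 ?poweR_ge0// lee_fin invr_ge0 ltW.
    rewrite [X in (_ <= _ * X)%E]EFinM muleA; apply: lee_wpmul2r.
      by rewrite lee_fin invr_ge0 ltW.
    rewrite -EFinM powRrM -powRM ?powR_ge0//; last by rewrite mulr_ge0// ltW.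
    rewrite -[X in (_ <= X)%E]poweR_EFin; apply: gt0_ler_poweR; rewrite ?(ltW q0)//.
    - by rewrite in_itv/= leey andbT mule_ge0 ?rearrangement_ge0// lee_fin powR_ge0.
    - by rewrite in_itv/= lee_fin leey andbT !mulr_ge0 ?powR_ge0// ltW.
    exact: est.
  rewrite ge0_integralZl_EFin ?powR_ge0//; first last.
  - apply/measurable_EFinP.
    apply: (@eq_measurable_fun _ _ _ _ I01 (fun t => t `^ (b * q - 1))).
      by move=> t; rewrite inE /I01/= in_itv/= => /andP[t0 _]; rewrite powR_sub1.
    by apply: measurable_funTS; exact: measurable_powR.
  - move=> t; rewrite /I01/= in_itv/= => /andP[t0 _].
    by rewrite lee_fin mulr_ge0 ?powR_ge0// invr_ge0 ltW.
  - exact: measurable_I01.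
  by rewrite EFinM; apply: lee_wpmul2l => //; rewrite lee_fin powR_ge0.
apply: (@le_trans _ _ (((q / p)%:E * ((C1 * A) `^ q * J)%:E) `^ q^-1)%E).
  apply: gt0_ler_poweR.
  - by rewrite invr_ge0 ltW.
  - rewrite in_itv/= leey andbT mule_ge0// integral_ge0// => t.
    rewrite /I01/= in_itv/= => /andP[t0 _].
    by rewrite mule_ge0 ?poweR_ge0// lee_fin invr_ge0 ltW.
  - by rewrite in_itv/= leey andbT -EFinM lee_fin; do 2!apply: mulr_ge0 => //; exact: powR_ge0.
  - by apply: lee_wpmul2l => //; rewrite lee_fin.
rewrite -EFinM poweR_EFin lee_fin mulrCA.
have C1A : 0 <= C1 * A by rewrite mulr_ge0// ltW.
have qpJ : 0 <= q / p * J by exact: mulr_ge0.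
rewrite [leLHS]powRM ?powR_ge0// -powRrM mulfV ?gt_eqF// powRr1//.
by rewrite mulrAC.
Qed.

End lorentz_estimates.

(** * The sequence spaces *)

Section ell_facts.
Context {R : realType}.
Variable r : R.
Hypothesis r1 : 1 <= r.
Implicit Types (x y : nat -> R) (A : R).

Definition psum x n : R := \sum_(i < n) `|x i| `^ r.

Definition ell_nrm x : R := fine (ell_norm r x).

Let r0 : 0 < r. Proof. exact: lt_le_trans ltr01 r1. Qed.

Lemma ell_normE x :
  ell_norm r x = ((\sum_(k <oo) (`|x k| `^ r)%:E) `^ r^-1)%E.
Proof. by rewrite /ell_norm Lnorm_counting. Qed.

Lemma ellE x : ell r x <-> (ell_norm r x < +oo)%E.
Proof.
rewrite /ell /=; split; first by case/andP => _; rewrite inE.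
by move=> h; apply/andP; split; rewrite inE.
Qed.

Lemma ell_norm_ge0 x : (0 <= ell_norm r x)%E.
Proof. exact: Lnorm_ge0. Qed.

Lemma ell_nrm_ge0 x : 0 <= ell_nrm x.
Proof. by rewrite /ell_nrm fine_ge0// ell_norm_ge0. Qed.

Lemma ell_nrmE x : ell r x -> ell_norm r x = (ell_nrm x)%:E.
Proof. by move=> /ellE h; rewrite /ell_nrm fineK// ge0_fin_numE// ell_norm_ge0. Qed.

Lemma psum_le_nrm x n : ell r x -> psum x n <= ell_nrm x `^ r.
Proof.
move=> lx; rewrite -lee_fin -poweR_EFin -ell_nrmE// ell_normE.
rewrite -poweRrM mulVf ?gt_eqF// poweRe1; last first.
  by apply: nneseries_ge0 => k _ _; rewrite lee_fin powR_ge0.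
rewrite /psum -sumEFin -(big_mkord xpredT (fun k => (`|x k| `^ r)%:E)).
by apply: nneseries_lim_ge => k _ _; rewrite lee_fin powR_ge0.
Qed.

Lemma psum_ge0 x n : 0 <= psum x n.
Proof. by apply: sumr_ge0 => i _; exact: powR_ge0. Qed.

Lemma ell_bounded x A : 0 <= A -> (forall n, psum x n <= A `^ r) ->
  ell r x /\ ell_nrm x <= A.
Proof.
move=> A0 xA.
have h : (ell_norm r x <= A%:E)%E.
  rewrite ell_normE; apply: (@le_trans _ _ ((A `^ r)%:E `^ r^-1)%E); last first.
    by rewrite poweR_EFin -powRrM mulfV ?gt_eqF// powRr1.
  apply: gt0_ler_poweR.
  - by rewrite invr_ge0 ltW.
  - rewrite in_itv/= leey andbT.
    by apply: nneseries_ge0 => k _ _; rewrite lee_fin powR_ge0.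
  - by rewrite in_itv/= leey andbT lee_fin powR_ge0.
  apply: lime_le.
    by apply: is_cvg_ereal_nneg_natsum => k _; rewrite lee_fin powR_ge0.
  by apply: nearW => n; rewrite sumEFin lee_fin big_mkord; exact: xA.
have lx : ell r x by apply/ellE; apply: le_lt_trans h _; exact: ltry.
by split => //; rewrite -lee_fin -ell_nrmE.
Qed.

Lemma ell_lin (a : R) x y : ell r x -> ell r y -> ell r ((a \*o x) \+ y).
Proof.
rewrite /ell/= !inE => lx ly.
have r1e : (1 <= r%:E)%E by rewrite lee_fin.
have := (Lfun_submod_closed (@counting nat R) r1e).2 a x y lx ly.
by [].
Qed.

Lemma ell_nrm_triangle x y : ell r x -> ell r y -> ell_nrm (x \+ y) <= ell_nrm x + ell_nrm y.
Proof.
move=> lx ly; have lxy : ell r (x \+ y).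
  by have := ell_lin 1 lx ly; congr (ell _ _); apply/funext => i /=; rewrite mul1r.
rewrite -lee_fin EFinD -!ell_nrmE// /ell_norm.
by apply: eminkowski => //; rewrite lee_fin.
Qed.

Lemma ell0 : ell r (cst 0) /\ ell_nrm (cst 0) = 0.
Proof.
have [//||l n] := @ell_bounded (cst 0) 0.
  move=> n; rewrite /psum big1 ?powR_ge0// => i _.
  by rewrite /cst normr0 powR0// gt_eqF.
by split => //; apply/eqP; rewrite eq_le n ell_nrm_ge0.
Qed.

Lemma ellD x y : ell r x -> ell r y -> ell r (x \+ y).
Proof.
move=> lx ly; have := ell_lin 1 lx ly; congr (ell _ _).
by apply/funext => i /=; rewrite mul1r.
Qed.

Lemma ellB x y : ell r x -> ell r y -> ell r (x \- y).
Proof.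
move=> lx ly; have := ell_lin (-1) ly lx; congr (ell _ _).
by apply/funext => i /=; rewrite mulN1r addrC.
Qed.

Lemma coord_le_nrm x i : ell r x -> `|x i| <= ell_nrm x.
Proof.
move=> lx; rewrite leNgt; apply/negP => h.
have := psum_le_nrm i.+1 lx; rewrite /psum big_ord_recr/=.
have : ell_nrm x `^ r < `|x i| `^ r by apply: gt0_ltr_powR; rewrite ?nnegrE ?ell_nrm_ge0.
have := psum_ge0 x i; rewrite /psum; lra.
Qed.

Lemma ell_nrm_eq0 x : ell r x -> ell_nrm x = 0 -> x = cst 0.
Proof.
move=> lx n0; apply/funext => i; apply/eqP; rewrite -normr_le0 -n0.
exact: coord_le_nrm.
Qed.

Lemma psum_cat x N n : psum x (N + n) = psum x N + psum (fun i => x (N + i)%N) n.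
Proof. by rewrite /psum big_split_ord. Qed.

Lemma psum_mono x m n : (m <= n)%N -> psum x m <= psum x n.
Proof. by move=> /subnKC <-; rewrite psum_cat lerDl psum_ge0. Qed.

Lemma ell_tail x (e : R) : ell r x -> 0 < e -> exists N0, forall N n, (N0 <= N)%N ->
  psum (fun i => x (N + i)%N) n <= e.
Proof.
move=> lx e0; pose S := range (psum x).
have hS : has_sup S.
  split; first by exists (psum x 0); exists 0%N.
  by exists (ell_nrm x `^ r) => _ [n _ <-]; exact: psum_le_nrm.
have [_ [N0 _ <-] hN0] := sup_adherent e0 hS.
exists N0 => N n NN0.
have h1 : psum x (N + n) <= sup S by apply: sup_ubound; [exact: hS.2|exists (N + n)%N].
have h2 := psum_mono x NN0.
by move: h1; rewrite psum_cat; lra.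
Qed.

(** Completeness, for a sequence with an explicit Cauchy modulus [e]. *)
Lemma ell_complete (X : nat -> nat -> R) (e : nat -> R) :
  (forall n, ell r (X n)) -> (forall d, 0 < d -> exists n, e n < d) ->
  (forall n m, ell_nrm (X n \- X m) <= e n + e m) ->
  exists2 x, ell r x & forall n, ell r (X n \- x) /\ ell_nrm (X n \- x) <= e n.
Proof.
move=> lX e_small Xe.
have e0 n : 0 <= e n by have := Xe n n; have := ell_nrm_ge0 (X n \- X n); lra.
have cX i n m : `|X n i - X m i| <= e n + e m.
  by apply: le_trans (Xe n m); apply: (@coord_le_nrm (X n \- X m)); exact: ellB.
(* All intervals [X n i - e n, X n i + e n] meet, so the infimum of the right
   ends belongs to each of them. *)
pose V i := [set X n i + e n | n in [set: nat]].
pose x i := inf (V i).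
have hV i : has_inf (V i).
  split; first by exists (X 0%N i + e 0%N); exists 0%N.
  exists (X 0%N i - e 0%N) => _ [n _ <-].
  by have := cX i n 0%N; rewrite ler_norml => /andP[]; lra.
have xX i n : `|X n i - x i| <= e n.
  rewrite ler_norml; apply/andP; split.
    rewrite lerBrDr addrC lerBlDr; apply: inf_lbound; first exact: (hV i).2.
    by exists n.
  rewrite lerBlDl -lerBlDr; apply: lb_le_inf; first exact: (hV i).1.
  by move=> _ [m _ <-]; have := cX i n m; rewrite ler_norml => /andP[]; lra.
(* The bound is proved for truncations to [N] terms, where coordinatewise
   approximation of [x] by [X m] is approximation in norm. *)
pose tr N (z : nat -> R) := fun i => if (i < N)%N then z i else 0.
have psum_tr N z n : psum (tr N z) n <= psum z N.
  have [nN|Nn] := leqP n N.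
    apply: le_trans (psum_mono z nN); apply: ler_sum => i _.
    by rewrite /tr (leq_trans (ltn_ord i) nN).
  rewrite -(subnKC (ltnW Nn)) psum_cat [X in _ + X]big1 ?addr0.
    by apply: ler_sum => i _; rewrite /tr ltn_ord.
  by move=> i _; rewrite /tr ltnNge leq_addr/= normr0 powR0// gt_eqF.
have main n N : psum (X n \- x) N <= e n `^ r.
  suff : ell_nrm (tr N (X n \- x)) <= e n.
    move=> h; apply: (@le_trans _ _ (ell_nrm (tr N (X n \- x)) `^ r)); last first.
      by apply: ge0_ler_powR; rewrite ?nnegrE ?ell_nrm_ge0// ltW.
    have lt : ell r (tr N (X n \- x)).
      apply: (@ell_bounded _ ((psum (X n \- x) N) `^ r^-1) _ _).1; first exact: powR_ge0.
      move=> k; rewrite -powRrM mulVf ?gt_eqF// powRr1 ?psum_ge0//.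
    apply: le_trans (psum_le_nrm N lt).
    by apply: ler_sum => i _; rewrite /tr ltn_ord.
  pose M := N%:R `^ r^-1 : R.
  have M0 : 0 <= M by exact: powR_ge0.
  apply/ler_addgt0Pr => d d0.
  have [m em] : exists m, e m < d / (1 + M) by apply: e_small; rewrite divr_gt0//; lra.
  have [l1 n1] : ell r (tr N (X n \- X m)) /\ ell_nrm (tr N (X n \- X m)) <= e n + e m.
    apply: ell_bounded; first by have := e0 n; have := e0 m; lra.
    move=> k; apply: le_trans (psum_tr _ _ _) _.
    apply: le_trans (psum_le_nrm _ (ellB (lX n) (lX m))) _.
    apply: ge0_ler_powR; rewrite ?nnegrE ?ell_nrm_ge0 ?(ltW r0)//.
    by have := e0 n; have := e0 m; lra.
  have [l2 n2] : ell r (tr N (X m \- x)) /\ ell_nrm (tr N (X m \- x)) <= M * e m.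
    apply: ell_bounded; first by rewrite mulr_ge0.
    move=> k; apply: le_trans (psum_tr _ _ _) _.
    rewrite powRM// /M -powRrM mulVf ?gt_eqF// powRr1//.
    apply: (@le_trans _ _ (\sum_(i < N) e m `^ r)).
      by apply: ler_sum => i _; apply: ge0_ler_powR; rewrite ?nnegrE ?(ltW r0)//; exact: xX.
    by rewrite sumr_const card_ord mulr_natl.
  have -> : tr N (X n \- x) = tr N (X n \- X m) \+ tr N (X m \- x).
    by apply/funext => i; rewrite /tr/=; case: ifPn => _; lra.
  apply: le_trans (ell_nrm_triangle l1 l2) _.
  have : (1 + M) * e m <= d by rewrite mulrC -ler_pdivlMr ?ltW//; lra.
  lra.
have lXx n := ell_bounded (e0 n) (main n).
exists x => //.
have := ellB (lX 0%N) (lXx 0%N).1; congr (ell _ _).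
by apply/funext => i /=; lra.
Qed.

End ell_facts.

(** * Almost everywhere equality and convergence in probability *)

Section almost_everywhere.
Context {R : realType}.
Notation mu := (@lebesgue_measure R).
Implicit Types (f g h : R -> R) (A B : set R).

Lemma pr_ae_le A B : measurable (I01 `&` A) -> measurable (I01 `&` B) ->
  {ae mu, forall t, I01 t -> A t -> B t} -> pr A <= pr B.
Proof.
move=> mA mB [N [mN muN sN]].
rewrite -lee_fin -!mu_prE//.
apply: (@le_trans _ _ (mu ((I01 `&` B) `|` N))).
  apply: le_measure; rewrite ?inE//; first exact: measurableU.
  move=> t [It At]; have [Nt|Nt] := pselect (N t); [by right|left].
  by split => //; apply: contrapT => Bt; apply: Nt; apply: sN => /= /(_ It At).
by apply: (le_trans (measureU2 _ _ _)) => //; rewrite /= muN adde0.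
Qed.

Lemma ae_eq01_pr f g s : measurable_fun I01 f -> measurable_fun I01 g -> ae_eq01 f g ->
  pr [set t | s < `|f t|] = pr [set t | s < `|g t|].
Proof.
move=> mf mg fg; apply/eqP; rewrite eq_le; apply/andP.
by split; apply: pr_ae_le; try exact: measurable_distribution;
  apply: filterS fg => t /= /[apply] ->.
Qed.

Lemma pr0_ae_eq01 f g : measurable_fun I01 f -> measurable_fun I01 g ->
  (forall s e : R, 0 < s -> 0 < e -> pr [set t | s < `|f t - g t|] <= e) -> ae_eq01 f g.
Proof.
move=> mf mg fg.
have mD (s : R) : measurable (I01 `&` [set t | s < `|f t - g t|]).
  by apply: (@measurable_distribution R (f \- g)); exact: measurable_funB.
pose F n := I01 `&` [set t : R | n.+1%:R^-1 < `|f t - g t|].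
have mF n : measurable (F n) by exact: mD.
have mU : measurable (\bigcup_n F n) by exact: bigcup_measurable.
exists (\bigcup_n F n); split=> //.
  apply/eqP; rewrite eq_le measure_ge0 andbT.
  apply: (@le_trans _ _ (\sum_(n <oo) mu (F n))%E).
    by apply: measure_sigma_subadditive.
  rewrite eseries0// => n _ _ /=; rewrite mu_prE//; congr (_%:E).
  apply/eqP; rewrite eq_le pr_ge0 andbT; apply/ler_addgt0Pr => e e0.
  by rewrite add0r; apply: fg => //; rewrite invr_gt0.
move=> t /= /not_implyP[It /eqP fgt].
have d0 : 0 < `|f t - g t| by rewrite normr_gt0 subr_eq0.
have [n _ /= hn] := near_infty_natSinv_lt (PosNum d0).
by exists n => //; split => //=; apply: hn => /=.
Qed.

Lemma pr_gt_add f g h s1 s2 s : s1 + s2 <= s ->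
  measurable_fun I01 f -> measurable_fun I01 g -> measurable_fun I01 h ->
  (forall t, I01 t -> `|f t| <= `|g t| + `|h t|) ->
  pr [set t | s < `|f t|] <= pr [set t | s1 < `|g t|] + pr [set t | s2 < `|h t|].
Proof.
move=> ss mf mg mh fgh; have mG := measurable_distribution s1 mg.
have mH := measurable_distribution s2 mh.
apply: le_trans (pr_union mG mH); apply: le_pr.
- exact: measurable_distribution.
- by rewrite setIUr; exact: measurableU.
move=> t It /= sf; have := fgh t It; have [?|?] := ltP s1 `|g t|; first by left.
by right => /=; lra.
Qed.

(** The reason why, for real functions, phase retrieval fails only through almost
    disjoint pairs. *)
Lemma min_norm_sub (a b : R) : `| `|a| - `|b| | = Num.min `|a - b| `|a + b|.
Proof.
have [a0|a0] := lerP 0 a; have [b0|b0] := lerP 0 b;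
  rewrite ?(ger0_norm a0) ?(ltr0_norm a0) ?(ger0_norm b0) ?(ltr0_norm b0).
- rewrite min_l//; rewrite [leRHS]ger0_norm ?addr_ge0// ler_norml.
  by apply/andP; split; lra.
- rewrite opprK min_r//; rewrite [leRHS]ger0_norm ?ler_norml; last by lra.
  by apply/andP; split; lra.
- rewrite -opprD normrN min_r//; rewrite [leRHS]ler0_norm ?ler_norml; last by lra.
  by apply/andP; split; lra.
- rewrite opprK addrC distrC min_l//; rewrite [leRHS]ltr0_norm ?ler_norml; last by lra.
  by apply/andP; split; lra.
Qed.

Lemma ae_eq01_lin (a : R) f f' g g' : ae_eq01 f f' -> ae_eq01 g g' ->
  ae_eq01 ((a \*o f) \+ g) ((a \*o f') \+ g').
Proof.
by move=> ff gg; apply: filterS2 ff gg => t /= ft gt It; rewrite ft// gt.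
Qed.

Lemma ae_eq01_sub f f' g g' : ae_eq01 f f' -> ae_eq01 g g' ->
  ae_eq01 (f \- g) (f' \- g').
Proof.
by move=> ff gg; apply: filterS2 ff gg => t /= ft gt It; rewrite ft// gt.
Qed.

Lemma ae_eq01_add f f' g g' : ae_eq01 f f' -> ae_eq01 g g' ->
  ae_eq01 (f \+ g) (f' \+ g').
Proof.
by move=> ff gg; apply: filterS2 ff gg => t /= ft gt It; rewrite ft// gt.
Qed.

Lemma ae_eq01_trans f g h : ae_eq01 f g -> ae_eq01 g h -> ae_eq01 f h.
Proof.
by move=> ff gg; apply: filterS2 ff gg => t /= ft gt It; rewrite ft// gt.
Qed.

Lemma ae_eq01_sym f g : ae_eq01 f g -> ae_eq01 g f.
Proof. by move=> ff; apply: filterS ff => t /= ft It; rewrite ft. Qed.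

End almost_everywhere.

(** * The range of a random series *)

Section random_series.
Context {R : realType}.
Variables (p : R) (q : \bar R) (r : R).
Hypotheses (p1 : 1 <= p) (q1 : (1 <= q)%E) (r1 : 1 <= r).
Variables (X sigma : R -> R) (K : R -> nat) (v y : nat -> R).
Hypothesis sch : symmetric_scheme X sigma K v y.
Variables m C d c : R.
Hypotheses (pm : p < m) (C0 : 0 < C) (d0 : 0 < d) (c0 : 0 < c) (c1 : c <= 1).
Hypothesis exit_le : forall n a (A s : R), 0 < A -> 0 < s -> psum r a n <= A `^ r ->
  pr (exit_event X sigma n a 0 s) <= C * (A / s) `^ m.
Hypothesis joint_ge : forall n a b (A B : R), 0 < A -> 0 < B ->
  A `^ r <= psum r a n -> B `^ r <= psum r b n ->
  c <= pr [set t | d * A < `|walk X sigma n a t| /\ d * B < `|walk X sigma n b t|].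
Notation W := (walk X sigma).

Let m0 : 0 < m. Proof. by apply: lt_trans pm; apply: lt_le_trans p1. Qed.
Let d4 : 0 < d / 4. Proof. by rewrite divr_gt0. Qed.
Let c20 : 0 < c / 2. Proof. by rewrite divr_gt0. Qed.
Let c40 : 0 < c / 4. Proof. by rewrite divr_gt0. Qed.
Let c21 : c / 2 <= 1. Proof. by have := c1; have := c0; lra. Qed.
Let c41 : c / 4 <= 1. Proof. by have := c1; have := c0; lra. Qed.

(** The limsup makes [T x] measurable for every [x], and [fine] turns the infinite
    values into 0.  The properties of [T x] come from its being the limit in
    probability of the partial sums ([series_map_cvg]). *)
Definition series_map (x : nat -> R) (t : R) : R :=
  fine (limn_esup (fun n => (W n x t)%:E)).
Notation T := series_map.

Lemma measurable_series_map x : measurable_fun setT (T x).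
Proof.
apply: (@measurableT_comp _ _ _ _ _ _ (@fine R)) => //.
apply: measurable_fun_limn_esup => n; apply/measurable_EFinP.
exact: measurable_walk sch n x.
Qed.

Let mT x : measurable_fun I01 (T x).
Proof. exact: measurable_funTS (measurable_series_map x). Qed.

Let mW n x : measurable_fun I01 (W n x).
Proof. exact: measurable_funTS (measurable_walk sch n x). Qed.

Lemma small_scale (s e : R) : 0 < s -> 0 < e -> exists2 A, 0 < A & C * (A / s) `^ m <= e.
Proof.
move=> s0 e0; exists (s * (e / C) `^ m^-1); first by rewrite mulr_gt0 ?powR_gt0 ?divr_gt0.
rewrite mulrAC mulfV ?gt_eqF// mul1r -powRrM mulVf ?gt_eqF// powRr1 ?divr_ge0 ?(ltW e0) ?(ltW C0)//.
by rewrite mulrCA mulfV ?gt_eqF// mulr1.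
Qed.

Lemma series_map_near x N s t :
  (forall n, `|W (N + n) x t - W N x t| < s) -> `|T x t - W N x t| <= s.
Proof.
move=> h; have s0 : 0 < s by apply: le_lt_trans (normr_ge0 _) (h 0%N).
pose u n := (W n x t)%:E.
have ub : (limn_esup u <= (W N x t + s)%:E)%E.
  rewrite limn_esup_lim; apply: lime_le; first exact: is_cvg_esups.
  near=> n; apply: ge_ereal_sup => _ [k /= nk <-]; rewrite lee_fin.
  have Nk : (N <= k)%N by apply: leq_trans nk; near: n; exists N.
  by have := h (k - N)%N; rewrite subnKC// ltr_norml => /andP[_]; lra.
have lb : ((W N x t - s)%:E <= limn_esup u)%E.
  rewrite limn_esup_lim; apply: lime_ge; first exact: is_cvg_esups.
  near=> n; apply: (@le_trans _ _ (u (maxn N n))).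
    rewrite lee_fin; have := h (maxn N n - N)%N; rewrite subnKC ?leq_maxl//.
    by rewrite ltr_norml => /andP[+ _]; lra.
  by apply: ereal_sup_ubound; exists (maxn N n) => //=; exact: leq_maxr.
rewrite /T -/u; case: (limn_esup u) ub lb => [l||]//=.
by rewrite !lee_fin => ? ?; rewrite ler_norml; apply/andP; split; lra.
Unshelve. all: by end_near. Qed.

(** [T x - W N x] is governed by the walk with coefficients [x (N + i)], started
    after [N] shifts, and shifts preserve the measure. *)
Lemma pr_tail_le x N (A s : R) : 0 < A -> 0 < s ->
  (forall n, psum r (fun i => x (N + i)%N) n <= A `^ r) ->
  pr [set t | s < `|T x t - W N x t|] <= C * (A / s) `^ m.
Proof.
move=> A0 s0 xA; pose x' i := x (N + i)%N.
pose B := \bigcup_n exit_event X sigma n x' 0 s.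
have mB : measurable B.
  by apply: bigcup_measurable => n _; exact: measurable_exit_event sch _ _ _ _.
have msB : measurable (iter N sigma @^-1` B).
  by rewrite -[X in measurable X]setTI; apply: (measurable_iter_shift sch).
apply: (@le_trans _ _ (pr (iter N sigma @^-1` B))).
  apply: le_pr.
  - by apply: (@measurable_distribution R (T x \- W N x)); exact: measurable_funB.
  - exact: measurable_I01I.
  move=> t _ /= st; apply: contrapT => Bt; move: st.
  rewrite ltNge => /negP; apply; apply: series_map_near => n.
  rewrite walk_cat addrAC subrr add0r ltNge; apply/negP => sn; apply: Bt.
  by exists n => //; exists n => //; rewrite add0r.
apply: le_trans (pr_iter_shift sch N mB) _.
apply: pr_bigcup_nondecreasing.
- by move=> n; exact: measurable_exit_event sch _ _ _ _.
- by move=> n t [k kn sk]; exists k => //; exact: leqW.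
- by move=> n; apply: exit_le.
Qed.

Lemma series_map_cvg x (s e : R) : ell r x -> 0 < s -> 0 < e ->
  exists N0, forall N, (N0 <= N)%N -> pr [set t | s < `|T x t - W N x t|] <= e.
Proof.
move=> lx s0 e0; have [A A0 hA] := small_scale s0 e0.
have [N0 hN0] := ell_tail r1 lx (powR_gt0 r A0).
exists N0 => N NN; apply: le_trans hA; apply: pr_tail_le => // n; exact: hN0.
Qed.

Lemma pr_series_map_le x (s : R) : ell r x -> 0 < s ->
  pr [set t | s < `|T x t|] <= C * (ell_nrm r x / s) `^ m.
Proof.
move=> lx s0.
have gen (A : R) : 0 < A -> ell_nrm r x <= A -> pr [set t | s < `|T x t|] <= C * (A / s) `^ m.
  move=> A0 xA; have := @pr_tail_le x 0%N A s A0 s0.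
  rewrite (_ : [set t | s < `|T x t - W 0 x t|] = [set t | s < `|T x t|]); last first.
    by apply/funext => t /=; rewrite subr0.
  apply => n; rewrite (_ : (fun i => x (0 + i)%N) = x)//.
  apply: le_trans (psum_le_nrm r1 n lx) _.
  apply: ge0_ler_powR; rewrite ?nnegrE ?ell_nrm_ge0 ?(ltW A0)//.
  exact: le_trans ler01 r1.
have [n0|n0] := ltP 0 (ell_nrm r x); first exact: gen.
have nx : ell_nrm r x = 0 by apply/eqP; rewrite eq_le n0 ell_nrm_ge0.
rewrite nx mul0r powR0 ?gt_eqF// mulr0; apply/ler_addgt0Pr => e e0; rewrite add0r.
have [A A0 hA] := small_scale s0 e0.
by apply: le_trans hA; apply: gen => //; rewrite nx ltW.
Qed.

(** Partial sums are linear in [x], and equality passes to the limit in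
    probability. *)
Lemma series_map_linear (a : R) x x' : ell r x -> ell r x' ->
  ae_eq01 (T ((a \*o x) \+ x')) ((a \*o T x) \+ T x').
Proof.
move=> lx lx'; have lz := ell_lin r1 a lx lx'; set z := (a \*o x) \+ x'.
have mr : measurable_fun I01 ((a \*o T x) \+ T x').
  by apply: measurable_funD => //; apply: measurable_funM.
apply: pr0_ae_eq01 => // s e s0 e0.
have s3 : 0 < s / 3 by lra.
have sa : 0 < s / 3 / (`|a| + 1) by rewrite divr_gt0// ltr_wpDl.
have e3 : 0 < e / 3 by lra.
have [N1 h1] := series_map_cvg lz s3 e3.
have [N2 h2] := series_map_cvg lx sa e3.
have [N3 h3] := series_map_cvg lx' s3 e3.
pose N := maxn N1 (maxn N2 N3).
have {}h1 := h1 N (leq_maxl _ _).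
have {}h2 := h2 N (leq_trans (leq_maxl _ _) (leq_maxr _ _)).
have {}h3 := h3 N (leq_trans (leq_maxr _ _) (leq_maxr _ _)).
have mTW w : measurable_fun I01 (T w \- W N w) by exact: measurable_funB.
have maTW : measurable_fun I01 (a \*o (T x \- W N x)) by exact: measurable_funM.
have mTWz' : measurable_fun I01 ((a \*o (T x \- W N x)) \+ (T x' \- W N x')).
  exact: measurable_funD.
have := @pr_gt_add _ (T z \- ((a \*o T x) \+ T x')) (T z \- W N z)
  ((a \*o (T x \- W N x)) \+ (T x' \- W N x')) (s / 3) (s / 3 + s / 3) s.
move=> /(_ _ _ _ _ _)/le_trans; apply.
- lra.
- exact: measurable_funB.
- exact: mTW.
- exact: mTWz'.
- move=> t _ /=; rewrite /z walk_linear.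
  set u1 := T _ t; set u2 := T x t; set u3 := T x' t; set w2 := W N x t; set w3 := W N x' t.
  rewrite (_ : u1 - (a * u2 + u3) =
    (u1 - (a * w2 + w3)) - (a * (u2 - w2) + (u3 - w3))); last by ring.
  exact: ler_normB.
have := @pr_gt_add _ ((a \*o (T x \- W N x)) \+ (T x' \- W N x'))
   (a \*o (T x \- W N x)) (T x' \- W N x') (s / 3) (s / 3) (s / 3 + s / 3) (lexx _).
move=> /(_ _ _ _ _)=> h.
have {}h := h mTWz' maTW (mTW x') (fun t _ => ler_normD _ _).
have h2' : pr [set t | s / 3 < `|(a \*o (T x \- W N x)) t|] <= e / 3.
  apply: le_trans h2; apply: le_pr; try exact: measurable_distribution.
    by apply: (@measurable_distribution R (T x \- W N x)).
  move=> t _ /=; rewrite normrM => ha.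
  rewrite ltr_pdivrMr ?ltr_wpDl// mulrDr mulr1.
  by have := normr_ge0 (T x t - W N x t); lra.
move: h1 h2' h3 h => /=; lra.
Qed.

Lemma series_map_sub x x' : ell r x -> ell r x' -> ae_eq01 (T (x \- x')) (T x \- T x').
Proof.
move=> lx lx'; have := series_map_linear (-1) lx' lx.
rewrite (_ : (-1 \*o x') \+ x = x \- x'); last by apply/funext => i /=; lra.
by rewrite (_ : (-1 \*o T x') \+ T x = T x \- T x')//; apply/funext => i /=; lra.
Qed.

Lemma series_map_add x x' : ell r x -> ell r x' -> ae_eq01 (T (x \+ x')) (T x \+ T x').
Proof.
move=> lx lx'; have := series_map_linear 1 lx lx'.
rewrite (_ : (1 \*o x) \+ x' = x \+ x'); last by apply/funext => i /=; lra.
by rewrite (_ : (1 \*o T x) \+ T x' = T x \+ T x')//; apply/funext => i /=; lra.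
Qed.

Let measurable_both (f g : R -> R) (s s' : R) :
  measurable_fun I01 f -> measurable_fun I01 g ->
  measurable (I01 `&` [set t | s < `|f t| /\ s' < `|g t|]).
Proof.
move=> mf mg; rewrite (_ : _ `&` _ =
    (I01 `&` [set t | s < `|f t|]) `&` (I01 `&` [set t | s' < `|g t|])).
  by apply: measurableI; exact: measurable_distribution.
by apply/seteqP; split=> t /=; tauto.
Qed.

Lemma half_nrm_le_psum x : ell r x -> 0 < ell_nrm r x ->
  exists N0, forall N, (N0 <= N)%N -> (ell_nrm r x / 2) `^ r <= psum r x N.
Proof.
move=> lx n0; have [N0 hN0] : exists N0, (ell_nrm r x / 2) `^ r < psum r x N0.
  apply: contrapT => /forallNP h.
  have h2 : 0 <= ell_nrm r x / 2 by lra.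
  have [|_] := @ell_bounded _ _ r1 x _ h2; last by lra.
  by move=> n; rewrite leNgt; apply/negP; exact: h.
by exists N0 => N NN; apply: le_trans (ltW hN0) _; exact: psum_mono.
Qed.

(** The joint lower bound for a long partial sum survives in the limit, at the cost
    of a factor 2 in the probability and 4 in the radius: one factor 2 for the
    truncated norms, one for the distance between [T x] and the partial sum. *)
Lemma pr_series_map_ge x x' : ell r x -> ell r x' -> 0 < ell_nrm r x -> 0 < ell_nrm r x' ->
  c / 2 <= pr [set t | d / 4 * ell_nrm r x < `|T x t| /\ d / 4 * ell_nrm r x' < `|T x' t|].
Proof.
move=> lx lx' nx nx'.
have [N1 h1] := half_nrm_le_psum lx nx.
have [N2 h2] := half_nrm_le_psum lx' nx'.
pose s := d / 4 * ell_nrm r x; pose s' := d / 4 * ell_nrm r x'.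
have s0 : 0 < s by rewrite mulr_gt0.
have s0' : 0 < s' by rewrite mulr_gt0.
have [N3 h3] := series_map_cvg lx s0 c40.
have [N4 h4] := series_map_cvg lx' s0' c40.
pose N := maxn (maxn N1 N2) (maxn N3 N4).
have {}h1 := h1 N (leq_trans (leq_maxl _ _) (leq_maxl _ _)).
have {}h2 := h2 N (leq_trans (leq_maxr _ _) (leq_maxl _ _)).
have {}h3 := h3 N (leq_trans (leq_maxl _ _) (leq_maxr _ _)).
have {}h4 := h4 N (leq_trans (leq_maxr _ _) (leq_maxr _ _)).
have nx2 : 0 < ell_nrm r x / 2 by lra.
have nx2' : 0 < ell_nrm r x' / 2 by lra.
have hJ := joint_ge nx2 nx2' h1 h2.
pose J := [set t | d * (ell_nrm r x / 2) < `|W N x t| /\ d * (ell_nrm r x' / 2) < `|W N x' t|].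
pose G := [set t | s < `|T x t| /\ s' < `|T x' t|].
pose D := [set t | s < `|T x t - W N x t|].
pose D' := [set t | s' < `|T x' t - W N x' t|].
have mJ : measurable (I01 `&` J) by exact: measurable_both.
have mG : measurable (I01 `&` G) by exact: measurable_both.
have mD : measurable (I01 `&` D).
  by apply: (@measurable_distribution R (T x \- W N x)); exact: measurable_funB.
have mD' : measurable (I01 `&` D').
  by apply: (@measurable_distribution R (T x' \- W N x')); exact: measurable_funB.
have mDD : measurable (I01 `&` (D `|` D')) by rewrite setIUr; exact: measurableU.
have : pr J <= pr (G `|` (D `|` D')).
  apply: le_pr => //; first by rewrite setIUr; exact: measurableU.
  move=> t _ [J1 J2].
  have [D1|D1] := ltP s `|T x t - W N x t|; first by right; left.
  have [D2|D2] := ltP s' `|T x' t - W N x' t|; first by right; right.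
  have k1 := ler_normB (T x t) (T x t - W N x t).
  have k2 := ler_normB (T x' t) (T x' t - W N x' t).
  rewrite !subKr in k1 k2.
  by left; split; [move: D1 J1 k1|move: D2 J2 k2]; rewrite /s /s'; lra.
move=> /le_trans/(_ (pr_union mG mDD)) hle.
have := pr_union mD mD'.
move: hJ h3 h4 hle; rewrite -/J -/D -/D' -/G.
by rewrite -[pr [set t | d / 4 * _ < _ /\ _]]/(pr G); lra.
Qed.

Lemma pr_series_map_ge1 x : ell r x -> 0 < ell_nrm r x ->
  c / 2 <= pr [set t | d / 4 * ell_nrm r x < `|T x t|].
Proof.
move=> lx nx; apply: le_trans (pr_series_map_ge lx lx nx nx) _.
by apply: le_pr; [exact: measurable_both|exact: measurable_distribution|move=> t _ []].
Qed.

Definition series_range : set (R -> R) :=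
  [set f | measurable_fun I01 f /\ exists2 x, ell r x & ae_eq01 (T x) f].

Lemma norm_series_upper : exists2 k : R, 0 <= k & forall x f, ell r x ->
  measurable_fun I01 f -> ae_eq01 (T x) f -> (lorentz_norm p q f <= (k * ell_nrm r x)%:E)%E.
Proof.
have [k k0 hk] := lorentz_norm_upper p1 q1 pm C0.
exists k => // x f lx mf xf; apply: hk; first exact: ell_nrm_ge0.
move=> s s0; rewrite distributionE// lee_fin -(ae_eq01_pr s (mT x) mf xf).
exact: pr_series_map_le.
Qed.

Lemma norm_series_lower : exists2 k : R, 0 < k & forall x f, ell r x ->
  measurable_fun I01 f -> ae_eq01 (T x) f -> ((k * ell_nrm r x)%:E <= lorentz_norm p q f)%E.
Proof.
have [k k0 hk] := lorentz_norm_lower p1 q1 c20 c21.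
exists (k * (d / 4)); first by rewrite mulr_gt0.
move=> x f lx mf xf.
have [nx|nx] := ltP 0 (ell_nrm r x); last first.
  have -> : ell_nrm r x = 0 by apply/eqP; rewrite eq_le nx ell_nrm_ge0.
  by rewrite mulr0; exact: lorentz_norm_ge0.
rewrite -mulrA; apply: hk => //; first by rewrite mulr_ge0 ?ell_nrm_ge0 ?(ltW d4).
rewrite -(ae_eq01_pr _ (mT x) mf xf); exact: pr_series_map_ge1.
Qed.

Lemma series_map_ell0 : ae_eq01 (T (cst 0)) (cst 0).
Proof.
apply: aeW => t _; rewrite /T.
have -> : (fun n => (W n (cst 0) t)%:E) = cst 0%E.
  apply/funext => n; congr (_%:E).
  by elim: n t => [//|n IH] t /=; rewrite mul0r add0r -[RHS](IH (sigma t)).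
by rewrite limn_esup_lim (_ : esups _ = cst 0%E) ?lim_cst//; apply/funext => n;
  rewrite /esups/=; apply/eqP; rewrite eq_le; apply/andP; split;
  [apply: ge_ereal_sup => _ [k _ <-]|apply: ereal_sup_ubound; exists n => //=].
Qed.

Lemma series_range_subspace : lorentz_subspace p q series_range.
Proof.
have [k k0 hk] := norm_series_upper.
split.
- move=> f [mf [x lx xf]]; split => //.
  by apply: le_lt_trans (hk x f lx mf xf) _; exact: ltry.
- split; first exact: measurable_cst.
  by exists (cst 0); [exact: (ell0 r1).1|exact: series_map_ell0].
- move=> a f g [mf [x lx xf]] [mg [x' lx' xg]]; split.
    by apply: measurable_funD => //; exact: measurable_funM.
  exists ((a \*o x) \+ x'); first exact: ell_lin.
  exact: ae_eq01_trans (series_map_linear a lx lx') (ae_eq01_lin a xf xg).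
- move=> f g [mf [x lx xf]] mg fg; split => //; exists x => //.
  exact: ae_eq01_trans xf fg.
Qed.

Lemma series_map_homeomorphism : linear_homeomorphism p q r series_range T.
Proof.
have [k k0 hk] := norm_series_upper.
have [l l0 hl] := norm_series_lower.
have lB := ellB r1.
have mTB x x' : measurable_fun I01 (T x \- T x') by exact: measurable_funB.
split.
- by move=> x lx; split => //; exists x => //; apply: aeW.
- by move=> a x x' lx lx'; exact: series_map_linear.
- split; last by move=> f [_ [x lx xf]]; exists x.
  move=> x x' lx lx' xx.
  suff /(ell_nrm_eq0 r1 (lB _ _ lx lx')) E0 : ell_nrm r (x \- x') = 0.
    by apply/funext => i; apply/eqP; rewrite -subr_eq0; have /= -> := congr1 (@^~ i) E0.
  have h0 : ae_eq01 (T (x \- x')) (cst 0).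
    apply: ae_eq01_trans (series_map_sub lx lx') _.
    by apply: filterS xx => t /= xt It; rewrite xt// subrr.
  have := hl (x \- x') (cst 0) (lB _ _ lx lx') (measurable_cst _) h0.
  move=> /le_trans/(_ (hk _ _ (ell0 r1).1 (measurable_cst _) series_map_ell0)).
  rewrite (ell0 r1).2 mulr0 lee_fin pmulr_rle0// => h.
  by apply/eqP; rewrite eq_le h ell_nrm_ge0.
- move=> x lx e e0; exists (e / (k + 1)); first by rewrite divr_gt0// ltr_wpDl.
  move=> x' lx'; rewrite ell_nrmE//; last exact: lB.
  rewrite lte_fin ltr_pdivlMr ?ltr_wpDl// => h.
  apply: le_lt_trans (hk (x \- x') _ (lB _ _ lx lx') (mTB x x') (series_map_sub lx lx')) _.
  rewrite lte_fin; have := ell_nrm_ge0 r (x \- x'); lra.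
move=> x lx e e0; exists (l * e); first by rewrite mulr_gt0.
move=> x' lx' h; rewrite ell_nrmE//; last exact: lB.
rewrite lte_fin -(ltr_pM2l l0) -lte_fin; apply: le_lt_trans h.
exact: hl (lB _ _ lx lx') (mTB x x') (series_map_sub lx lx').
Qed.

Lemma norm_lt_pr (e : R) : 0 < e -> e <= 1 -> exists2 k : R, 0 < k &
  forall f s, measurable_fun I01 f -> 0 <= s -> (lorentz_norm p q f < (k * s)%:E)%E ->
    pr [set t | s < `|f t|] < e.
Proof.
move=> e0 e1; have [k k0 hk] := lorentz_norm_lower p1 q1 e0 e1.
exists k => // f s mf s0 fs; rewrite ltNge; apply/negP => /(hk _ _ mf s0).
by rewrite leNgt fs.
Qed.

(** If [g n] tends to [f] in quasi-norm, the [g n] are Cauchy in probability;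
    non-concentration turns this into a Cauchy sequence of coefficients. *)
Lemma series_range_closed : lorentz_closed p q series_range.
Proof.
move=> f [mf _] hf; split => //.
have /choice[G hG] : forall n, exists gx : (R -> R) * (nat -> R),
    [/\ measurable_fun I01 gx.1, ell r gx.2, ae_eq01 (T gx.2) gx.1 &
     (lorentz_norm p q (f \- gx.1)%R < (n.+1%:R^-1)%:E)%E].
  move=> n; have [|g [mg [x lx xg]] fg] := hf n.+1%:R^-1; first by rewrite invr_gt0.
  by exists (g, x).
pose g n := (G n).1; pose x n := (G n).2.
have mg n : measurable_fun I01 (g n) by have [] := hG n.
have lx n : ell r (x n) by have [] := hG n.
have xg n : ae_eq01 (T (x n)) (g n) by have [] := hG n.
have fg n : (lorentz_norm p q (f \- g n)%R < (n.+1%:R^-1)%:E)%E by have [] := hG n.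
have mfg n : measurable_fun I01 (f \- g n) by exact: measurable_funB.
(* At level [c / 4] two approximants together miss less than [c / 2], the
   probability given by [pr_series_map_ge1]. *)
have [k k0 hk] := norm_lt_pr c40 c41.
have close n : pr [set t | n.+1%:R^-1 / k < `|(f \- g n) t|] < c / 4.
  apply: hk => //; first by rewrite divr_ge0 ?invr_ge0// ltW.
  by rewrite mulrCA mulfV ?gt_eqF// mulr1.
pose en n : R := n.+1%:R^-1 * (k^-1 * (d / 4)^-1).
have k00 : 0 < k^-1 * (d / 4)^-1 by rewrite mulr_gt0// invr_gt0.
have small (e : R) : 0 < e -> exists N, forall n, (N <= n)%N -> n.+1%:R^-1 < e.
  by move=> e0; have [N _ hN] := near_infty_natSinv_lt (PosNum e0); exists N => n /hN.
have en_small e : 0 < e -> exists n, en n < e.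
  move=> e0; have [|N hN] := small (e / (k^-1 * (d / 4)^-1)); first by rewrite divr_gt0.
  by exists N; rewrite /en -ltr_pdivlMr//; exact: hN.
have [n n'|x0 lx0 hx0] := @ell_complete _ r r1 x en lx en_small.
  have lB := ellB r1 (lx n) (lx n').
  rewrite leNgt; apply/negP => hn.
  have np : 0 < ell_nrm r (x n \- x n').
    by apply: le_lt_trans hn; rewrite addr_ge0// mulr_ge0 ?invr_ge0// ltW.
  have h1 := pr_series_map_ge1 lB np.
  have aeq : ae_eq01 (T (x n \- x n')) (g n \- g n').
    exact: ae_eq01_trans (series_map_sub (lx n) (lx n')) (ae_eq01_sub (xg n) (xg n')).
  rewrite (ae_eq01_pr _ (mT _) _ aeq) in h1; last exact: measurable_funB.
  have := @pr_gt_add _ (g n \- g n') (f \- g n) (f \- g n')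
    (n.+1%:R^-1 / k) (n'.+1%:R^-1 / k) (d / 4 * ell_nrm r (x n \- x n')).
  move=> /(_ _ (measurable_funB (mg n) (mg n')) (mfg n) (mfg n')) h2.
  have c1' := close n; have c2' := close n'.
  suff : c / 2 < c / 2 by rewrite ltxx.
  apply: le_lt_trans h1 _.
  apply: le_lt_trans (h2 _ _) _.
  - move: hn; rewrite /en -mulrDl mulrA ltr_pdivrMr// => /ltW.
    by rewrite mulrDl [ell_nrm _ _ * _]mulrC.
  - move=> t _ /=; rewrite [leRHS]addrC.
    rewrite (_ : g n t - g n' t = (f t - g n' t) - (f t - g n t)); last by ring.
    exact: ler_normB.
  - lra.
exists x0 => //; apply: ae_eq01_sym; apply: pr0_ae_eq01 => // s e s0 e0.
wlog e1 : e e0 / e <= 1.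
  move=> h; have [e1|e1] := leP e 1; first exact: h.
  by apply: le_trans (ltW e1); apply: h.
have s2 : 0 < s / 2 by lra.
have e2 : 0 < e / 2 by lra.
have e21 : e / 2 <= 1 by lra.
have [k' k'0 hk'] := norm_lt_pr e2 e21.
have [A A0 hA] := small_scale s2 e2.
have [|N1 hN1] := small (k' * (s / 2)); first by rewrite mulr_gt0.
have [|N2 hN2] := small (A / (k^-1 * (d / 4)^-1)); first by rewrite divr_gt0.
pose N := maxn N1 N2.
have [lN nN] := hx0 N.
have mT0 : measurable_fun I01 (g N \- T x0) by exact: measurable_funB.
have mf0 : measurable_fun I01 (f \- T x0) by exact: measurable_funB.
have aeq : ae_eq01 (T (x N \- x0)) (g N \- T x0).
  apply: ae_eq01_trans (series_map_sub (lx N) lx0) (ae_eq01_sub (xg N) _).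
  exact: aeW.
have h1 : pr [set t | s / 2 < `|(f \- g N) t|] < e / 2.
  apply: hk' => //; first exact: ltW.
  by apply: lt_trans (fg N) _; rewrite lte_fin; apply: hN1; exact: leq_maxl.
have h2 : pr [set t | s / 2 < `|(g N \- T x0) t|] <= e / 2.
  rewrite -(ae_eq01_pr _ (mT _) mT0 aeq).
  apply: le_trans (pr_series_map_le lN s2) _; apply: le_trans hA.
  rewrite ler_wpM2l ?(ltW C0)//.
  have nA : ell_nrm r (x N \- x0) <= A.
    apply: le_trans nN _; rewrite /en -ler_pdivlMr//; apply: ltW; apply: hN2.
    exact: leq_maxr.
  apply: ge0_ler_powR; rewrite ?nnegrE ?divr_ge0 ?ell_nrm_ge0 ?(ltW m0) ?(ltW A0) ?(ltW s0)//.
  by rewrite ler_wpM2r// invr_ge0 ltW.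
have := @pr_gt_add _ (f \- T x0) (f \- g N) (g N \- T x0) (s / 2) (s / 2) s.
move=> /(_ _ mf0 (mfg N) mT0 _)/le_trans; apply => /=.
- lra.
- move=> t _; rewrite (_ : f t - T x0 t = (f t - g N t) + (g N t - T x0 t)); last by ring.
  exact: ler_normD.
- by move: h1 h2 => /=; lra.
Qed.

(** With [f = T x], [g = T x'], apply the joint lower bound to [x - x'] and
    [x + x']: on a set of probability [c / 2] both |f - g| and |f + g|, hence
    | |f| - |g| |, exceed a multiple of the smaller of the two norms. *)
Lemma series_range_spr : stable_phase_retrieval p q series_range.
Proof.
have [k k0 hk] := norm_series_upper.
have [l l0 hl] := lorentz_norm_lower p1 q1 c20 c21.
have ld : 0 < l * (d / 4) by rewrite mulr_gt0.
exists (k / (l * (d / 4))) => f g [mf [x lx xf]] [mg [x' lx' xg]].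
have mD : measurable_fun I01 ((Num.norm \o f) \- (Num.norm \o g)).
  by apply: measurable_funB; exact: measurableT_comp.
have lu := ellB r1 lx lx'; have lv := ellD r1 lx lx'.
have mfg := measurable_funB mf mg; have mfg' := measurable_funD mf mg.
have uE := ae_eq01_trans (series_map_sub lx lx') (ae_eq01_sub xf xg).
have vE := ae_eq01_trans (series_map_add lx lx') (ae_eq01_add xf xg).
set u := x \- x' in lu uE; set v' := x \+ x' in lv vE.
have hu := hk _ _ lu mfg uE; have hv := hk _ _ lv mfg' vE.
set B := Num.min (ell_nrm r u) (ell_nrm r v').
have B0 : 0 <= B by rewrite le_min !ell_nrm_ge0.
apply: (@le_trans _ _ (k * B)%:E).
  by rewrite /B; case: (leP (ell_nrm r u) (ell_nrm r v')) => _; rewrite ge_min ?hu ?hv ?orbT.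
suff h : ((l * (d / 4 * B))%:E <=
    lorentz_norm p q ((Num.norm \o f) \- (Num.norm \o g))%R)%E.
  apply: (@le_trans _ _ ((k / (l * (d / 4)))%:E * (l * (d / 4 * B))%:E)%E); last first.
    by apply: lee_wpmul2l => //; rewrite lee_fin divr_ge0// ltW.
  rewrite -EFinM lee_fin le_eqVlt; apply/orP; left; apply/eqP; field.
  by rewrite !gt_eqF.
have [Bp|Bn] := ltP 0 B; last first.
  have -> : B = 0 by apply/eqP; rewrite eq_le Bn B0.
  by rewrite !mulr0; exact: lorentz_norm_ge0.
apply: hl => //; first by rewrite mulr_ge0// ltW.
have [nu nv] : 0 < ell_nrm r u /\ 0 < ell_nrm r v' by move: Bp; rewrite lt_min => /andP[].
apply: le_trans (pr_series_map_ge lu lv nu nv) _.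
apply: pr_ae_le.
- exact: measurable_both.
- exact: measurable_distribution.
apply: filterS2 uE vE => t /= ut vt It [].
rewrite ut// vt//= min_norm_sub lt_min => h1 h2; apply/andP; split.
  by apply: le_lt_trans h1; rewrite ler_wpM2l ?(ltW d4)// /B ge_min lexx.
by apply: le_lt_trans h2; rewrite ler_wpM2l ?(ltW d4)// /B ge_min lexx orbT.
Qed.

Theorem series_range_copy_spr : exists E : set (R -> R),
  copy_of_ell p q r E /\ stable_phase_retrieval p q E.
Proof.
exists series_range; split; last exact: series_range_spr.
split; [exact: series_range_subspace|exact: series_range_closed|].
by exists T; exact: series_map_homeomorphism.
Qed.

End random_series.

(** * Scaling *)

Section scaling.
Context {R : realType}.
Variables (X sigma : R -> R).
Implicit Types (a : nat -> R) (l s : R).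

Lemma walk_scale n l a t : walk X sigma n (fun i => l * a i) t = l * walk X sigma n a t.
Proof. by elim: n a t => [|n IH] a t /=; rewrite ?mulr0// IH mulrDr mulrA. Qed.

Lemma psum_scale r n l a : 0 <= l -> psum r (fun i => l * a i) n = l `^ r * psum r a n.
Proof.
move=> l0; rewrite /psum mulr_sumr; apply: eq_bigr => i _.
by rewrite normrM (ger0_norm l0) powRM.
Qed.

Lemma exit_event_scale n l s a : 0 < l ->
  exit_event X sigma n a 0 s = exit_event X sigma n (fun i => l * a i) 0 (l * s).
Proof.
move=> l0; apply/seteqP; split => t [k kn]; rewrite add0r => sk; exists k => //;
  move: sk; by rewrite ?add0r walk_scale normrM (gtr0_norm l0) ler_pM2l.
Qed.

Lemma psum_shift r n a : psum r a n.+1 = `|a 0%N| `^ r + psum r (fun i => a i.+1) n.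
Proof. by rewrite /psum big_ord_recl. Qed.

End scaling.

(** * Heavy-tailed steps: the spaces l_r with 1 < r < 2 *)

Section heavy_tail.
Context {R : realType}.
Variable r : R.
Hypotheses (r1 : 1 < r) (r2 : r < 2).

Let r0 : 0 < r. Proof. exact: lt_trans ltr01 r1. Qed.

(** The step has absolute value [ratio^k] with probability [2^(-k-1)]; the ratio is
    chosen so that P(|X| >= s) is of order [s^(-r)]. *)
Definition ratio : R := 2 `^ r^-1.
Definition pareto (k : nat) : R := ratio ^+ k.
Definition heavy_digit := digit (@dyadic R) pareto.
Definition heavy_shift := shift (@dyadic R).
Notation v := (weight (@dyadic R)).
Notation W := (walk heavy_digit heavy_shift).

Lemma heavy_scheme : symmetric_scheme heavy_digit heavy_shift (level (@dyadic R)) v pareto.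
Proof.
apply: bernoulli_symmetric_scheme.
- by rewrite /dyadic expr0.
- exact: dyadic_nonincreasing.
- by move=> k; exact/ltW/dyadic_gt0.
- exact: dyadic_small.
Qed.

Lemma weight_dyadic k : v k = 2^-1 ^+ k / 4.
Proof. by rewrite /weight /dyadic exprS; field. Qed.

Lemma ratio_gt0 : 0 < ratio. Proof. by rewrite powR_gt0. Qed.

Lemma ratio_powr : ratio `^ r = 2.
Proof. by rewrite /ratio -powRrM mulVf ?gt_eqF// powRr1. Qed.

Lemma ratio_sqr_gt2 : 2 < ratio ^+ 2.
Proof.
rewrite -powR_mulrn ?(ltW ratio_gt0)// -[ltLHS]ratio_powr.
have l1 : 1 < ratio.
  have <- : 1 `^ r^-1 = 1 :> R by rewrite powR1.
  by apply: gt0_ltr_powR; rewrite ?invr_gt0 ?nnegrE//; lra.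
rewrite /powR gt_eqF ?ratio_gt0// ltr_expR ltr_pM2r//.
by rewrite ln_gt0.
Qed.

Lemma ratio_gt : 7/5 < ratio.
Proof. by have := ratio_sqr_gt2; have := ratio_gt0; nra. Qed.

Lemma pareto_powr k (a : R) : `|a * ratio ^+ k| `^ r = `|a| `^ r * 2 ^+ k.
Proof.
rewrite normrM powRM// [`|ratio ^+ k|]ger0_norm ?exprn_ge0 ?(ltW ratio_gt0)//; congr (_ * _).
by rewrite -powR_mulrn ?(ltW ratio_gt0)// -powRrM mulrC powRrM ratio_powr powR_mulrn.
Qed.

Definition sqr1 (x : R) := Num.min (x ^+ 2) 1.

Lemma sqr1_ge0 x : 0 <= sqr1 x.
Proof. by rewrite /sqr1 le_min sqr_ge0 ler01. Qed.

(** Truncated form of the parallelogram identity.  It replaces both the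
    orthogonality of truncated steps and the union bound for large ones. *)
Lemma sqr1_parallelogram x h : sqr1 (x + h) + sqr1 (x - h) <= 2 * sqr1 x + 2 * sqr1 h.
Proof.
have le1 z : sqr1 z <= 1 by rewrite /sqr1 ge_min lexx orbT.
have leS z : sqr1 z <= z ^+ 2 by rewrite /sqr1 ge_min lexx.
have := le1 (x + h); have := le1 (x - h); have := leS (x + h); have := leS (x - h).
have := sqr1_ge0 x; have := sqr1_ge0 h.
rewrite [sqr1 x]/sqr1 [sqr1 h]/sqr1.
case: (leP (x ^+ 2) 1); case: (leP (h ^+ 2) 1) => *; nra.
Qed.

(** Partial sums of E min((a X)^2, 1). *)
Definition mean_sqr1 n a := \sum_(k < n) 2 * v k * sqr1 (a * pareto k).

Lemma mean_sqr1S n a : mean_sqr1 n.+1 a = sqr1 a / 2 + mean_sqr1 n (a * ratio) / 2.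
Proof.
rewrite /mean_sqr1 big_ord_recl/= weight_dyadic /pareto !expr0 mulr1; congr (_ + _).
  by field.
rewrite mulr_suml; apply: eq_bigr => k _.
by rewrite !weight_dyadic /bump/= add1n !exprS mulrA; field.
Qed.

(** The constants solve the induction of [mean_sqr1_le_small]: under
    [a -> a * ratio] followed by halving, [|a|^r] is invariant while [a^2] is
    multiplied by [growth > 1], so the negative term
    [- quad_coef * a^2] absorbs the contribution [a^2 / 2] of the first level. *)
Definition growth : R := ratio ^+ 2 / 2.
Definition quad_coef : R := (2 * (growth - 1))^-1.
Definition moment_coef : R := 1 + quad_coef * ratio ^+ 2.

Lemma growth_gt1 : 1 < growth. Proof. by rewrite /growth; have := ratio_sqr_gt2; lra. Qed.
Lemma quad_coef_gt0 : 0 < quad_coef.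
Proof. by rewrite /quad_coef invr_gt0; have := growth_gt1; lra. Qed.
Lemma moment_coef_ge1 : 1 <= moment_coef.
Proof. by rewrite /moment_coef lerDl mulr_ge0 ?sqr_ge0// ltW// quad_coef_gt0. Qed.

Lemma mean_sqr1_le1 n a : mean_sqr1 n a <= 1.
Proof.
apply: le_trans (scheme_weight_sum heavy_scheme n); apply: ler_sum => k _.
rewrite ler_piMr//; last by rewrite /sqr1 ge_min lexx orbT.
by rewrite mulr_ge0// (scheme_weight_ge0 heavy_scheme).
Qed.

Lemma powr_ge1 (a : R) : 1 <= `|a| -> 1 <= `|a| `^ r.
Proof.
move=> a1; have <- : 1 `^ r = 1 :> R by rewrite powR1.
by apply: ge0_ler_powR; rewrite ?nnegrE// ltW.
Qed.

Lemma sqr_le_powr (a : R) : `|a| <= 1 -> a ^+ 2 <= `|a| `^ r.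
Proof.
move=> a1; have [->|a0] := eqVneq a 0; first by rewrite expr0n/= powR_ge0.
rewrite -real_normK ?num_real// -powR_mulrn//.
by apply: ger_powR; [rewrite normr_gt0 a0|exact: ltW].
Qed.

(** For [|a| <= 1] this is the invariance explained above; for
    [1 < |a| <= ratio] the right-hand side is at least 1 by choice of
    [moment_coef]. *)
Lemma mean_sqr1_le_small n (a : R) : `|a| <= ratio ->
  mean_sqr1 n a <= moment_coef * `|a| `^ r - quad_coef * a ^+ 2.
Proof.
have D0p := quad_coef_gt0; have l0 := ratio_gt0.
have D01 : quad_coef <= moment_coef.
  rewrite /moment_coef; have := ratio_sqr_gt2; nra.
have big b : 1 < `|b| -> `|b| <= ratio -> 1 <= moment_coef * `|b| `^ r - quad_coef * b ^+ 2.
  move=> b1 bl; have p1 := powr_ge1 (ltW b1).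
  have b2 : b ^+ 2 <= ratio ^+ 2.
    by rewrite -real_normK ?num_real// ler_pXn2r// nnegrE// ltW.
  have : quad_coef * b ^+ 2 <= quad_coef * ratio ^+ 2 by rewrite ler_wpM2l// ltW.
  have : moment_coef * 1 <= moment_coef * `|b| `^ r.
    by rewrite ler_wpM2l//; have := moment_coef_ge1; lra.
  rewrite mulr1 [in X in X <= _]/moment_coef; lra.
elim: n a => [|n IH] a corr_coef.
  rewrite /mean_sqr1 big_ord0; have [b1|a1] := ltP 1 `|a|.
    by apply: le_trans (big _ b1 corr_coef).
  rewrite subr_ge0; apply: ler_pM; rewrite ?sqr_ge0 ?(ltW D0p)//.
  exact: sqr_le_powr.
have [b1|a1] := ltP 1 `|a|; first exact: le_trans (mean_sqr1_le1 _ _) (big _ b1 corr_coef).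
rewrite mean_sqr1S.
have h : `|a * ratio| <= ratio by rewrite normrM (gtr0_norm l0) ler_piMl// ltW.
have := IH _ h; have := pareto_powr 1 a; rewrite !expr1 => ->.
have : sqr1 a <= a ^+ 2 by rewrite /sqr1 ge_min lexx.
have : quad_coef * (a * ratio) ^+ 2 = (2 * quad_coef * growth) * a ^+ 2 by rewrite /growth; field.
have : 2 * quad_coef * growth = 2 * quad_coef + 1.
  by rewrite /quad_coef; field; have := growth_gt1; lra.
by move=> -> -> /= ? ?; have := sqr_ge0 a; lra.
Qed.

Lemma mean_sqr1_le n (a : R) : mean_sqr1 n a <= moment_coef * `|a| `^ r.
Proof.
have [corr_coef|corr_coef] := leP `|a| ratio.
  apply: le_trans (mean_sqr1_le_small n corr_coef) _.
  by rewrite gerBl mulr_ge0 ?sqr_ge0// ltW// quad_coef_gt0.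
apply: le_trans (mean_sqr1_le1 n a) _.
have : 1 <= `|a| `^ r by apply: powr_ge1; have := ratio_gt; lra.
have := moment_coef_ge1; nra.
Qed.

(** The function [sqr1 x + moment_coef * psum r a n] decreases in mean. *)
Lemma heavy_exit_le n a (A s : R) : 0 < A -> 0 < s ->
  psum r a n <= A `^ r ->
  pr (exit_event heavy_digit heavy_shift n a 0 s) <= moment_coef * (A / s) `^ r.
Proof.
move=> A0 s0 aA; have s10 : 0 < s^-1 by rewrite invr_gt0.
rewrite (exit_event_scale _ _ _ _ _ s10) mulVf ?gt_eqF//; set b := fun i => _.
have D1p : 0 <= moment_coef by have := moment_coef_ge1; lra.
have pos n' b' x : 0 <= sqr1 x + moment_coef * psum r b' n'.
  by rewrite addr_ge0 ?sqr1_ge0// mulr_ge0// psum_ge0.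
apply: le_trans (@pr_exit_le _ _ _ _ _ _ heavy_scheme
   (fun n a x => sqr1 x + moment_coef * psum r a n) 1 _ _ _ n b 0) _.
- exact: pos.
- move=> n' b' x x1; suff -> : sqr1 x = 1 by rewrite lerDl mulr_ge0// psum_ge0.
  rewrite /sqr1 min_r// -real_normK ?num_real//.
  by rewrite exprn_ege1.
- move=> n' b' x N; rewrite psum_shift; set P := psum r _ n'.
  apply: (@le_trans _ _ (\sum_(k < N) (2 * v k * (sqr1 x + moment_coef * P) +
      2 * v k * sqr1 (b' 0%N * pareto k)))).
    apply: ler_sum => k _; have := sqr1_parallelogram x (b' 0%N * pareto k).
    have : 0 <= v k by exact: scheme_weight_ge0 heavy_scheme k.
    set u1 := sqr1 (_ + _); set u2 := sqr1 (_ - _); set u3 := sqr1 x; set u4 := sqr1 _.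
    move=> vk0 hp; have := ler_wpM2l vk0 hp; lra.
  rewrite big_split/= -mulr_suml.
  have h1 := mean_sqr1_le N (b' 0%N); rewrite /mean_sqr1 in h1.
  have h2 : (\sum_(i < N) 2 * v i) * (sqr1 x + moment_coef * P) <= sqr1 x + moment_coef * P.
    by rewrite ler_piMl ?pos//; exact: scheme_weight_sum heavy_scheme N.
  by rewrite mulrDr; lra.
have -> : sqr1 0 = 0 by rewrite /sqr1 expr0n/= min_l.
rewrite add0r ler_wpM2l// /b psum_scale ?invr_ge0 ?(ltW s0)//.
rewrite [A / s]mulrC powRM ?invr_ge0 ?(ltW s0) ?(ltW A0)//.
by rewrite ler_wpM2l ?powR_ge0.
Qed.

(** The first level [m] at which the step [a X] reaches size 1: the step is below
    that size with probability [1 - 2^(-m)], which is at most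
    [exp (- |a|^r / 2)] by minimality of [m]. *)
Lemma level_crossing (a : R) : a != 0 -> exists m, 1 <= `|a| * ratio ^+ m /\
  (1 - 2^-1 ^+ m <= expR (- (`|a| `^ r / 2))).
Proof.
move=> a0; have l0 := ratio_gt0.
have powE k : (`|a| * ratio ^+ k) `^ r = `|a| `^ r * 2 ^+ k.
  by rewrite -pareto_powr normrM [`|ratio ^+ k|]ger0_norm// exprn_ge0// ltW.
have ex : exists m, 1 <= `|a| * ratio ^+ m.
  have [m hm] : exists m, 2^-1 ^+ m <= `|a| `^ r.
    by apply: dyadic_small; rewrite powR_gt0 ?normr_gt0.
  exists m; rewrite leNgt; apply/negP => h.
  have : (`|a| * ratio ^+ m) `^ r < 1 `^ r.
    by apply: gt0_ltr_powR; rewrite ?nnegrE// mulr_ge0// exprn_ge0// ltW.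
  rewrite powE powR1 => h1.
  have : 2^-1 ^+ m * 2 ^+ m <= `|a| `^ r * 2 ^+ m by rewrite ler_wpM2r// exprn_ge0.
  by rewrite exprVn mulVf ?expf_neq0//; lra.
case: (ex_minnP ex) => m hm mmin; exists m; split => //.
case: m hm mmin => [|m] hm mmin; first by rewrite expr0 subrr expR_ge0.
apply: le_trans (expR_ge1Dx _); rewrite lerD2l lerN2.
have h : `|a| * ratio ^+ m < 1 by rewrite ltNge; apply/negP => /mmin; rewrite ltnn.
have : (`|a| * ratio ^+ m) `^ r <= 1 `^ r.
  by apply: ge0_ler_powR; rewrite ?nnegrE ?(ltW r0) ?(ltW h)// mulr_ge0// exprn_ge0// ltW.
rewrite powE powR1 -ler_pdivlMr ?exprn_gt0// mul1r exprS -exprVn => h1.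
by rewrite mulrC; lra.
Qed.

Lemma pareto_separated (a : R) k k' (e e' : bool) : k != k' -> 1 <= `|a| * ratio ^+ k ->
  1 <= `|a| * ratio ^+ k' ->
  2 / 5 < `|((-1) ^+ e * (a * pareto k)) - ((-1) ^+ e' * (a * pareto k'))|.
Proof.
have l0 := ratio_gt0; have lg := ratio_gt.
have gap i j : (i < j)%N -> 1 <= `|a| * ratio ^+ i ->
    2 / 5 < `|a| * ratio ^+ j - `|a| * ratio ^+ i.
  move=> ij ai; rewrite -(subnKC ij) addSnnS exprD mulrA.
  have : ratio <= ratio ^+ (j - i.+1).+1.
    by rewrite exprS ler_peMr ?(ltW l0)// exprn_ege1//; lra.
  set L := ratio ^+ _.+1; set z := `|a| * _ in ai *; nra.
have nE (f : bool) i : `|(-1) ^+ f * (a * pareto i)| = `|a| * ratio ^+ i.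
  by rewrite normrM normr_sign mul1r normrM [X in _ * X]ger0_norm// exprn_ge0// ltW.
move=> kk ak ak'; apply: lt_le_trans (ler_dist_dist _ _).
rewrite !nE; move: kk; rewrite neq_ltn => /orP[] lt.
  by rewrite distrC; apply: lt_le_trans (ler_norm _); exact: gap.
by apply: lt_le_trans (ler_norm _); exact: gap.
Qed.

Let measurable_ball (w : R -> R) (x s : R) : measurable_fun setT w ->
  measurable [set t | `|x + w t| <= s].
Proof.
move=> mw; rewrite -[X in measurable X]setTI.
apply: (@measurable_fun_ler _ _ _ _ (fun t => `|x + w t|) (cst s)) => //.
by apply: measurableT_comp => //; exact: measurable_funD.
Qed.

(** Distinct values of a step of size at least 1 are more than 2/5 apart, so the
    events below, one for each value, are pairwise disjoint. *)
Lemma sum_pr_translates (a x : R) (w : R -> R) m N : measurable_fun setT w ->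
  1 <= `|a| * ratio ^+ m ->
  \sum_(i < N) (pr [set t | `|x + a * pareto (m + i)%N + w t| <= 5^-1] +
     pr [set t | `|x - a * pareto (m + i)%N + w t| <= 5^-1]) <= 1.
Proof.
move=> mw am; have l0 := ratio_gt0; have lg := ratio_gt.
have big i : 1 <= `|a| * ratio ^+ (m + i).
  rewrite exprD mulrA; apply: le_trans am _; rewrite ler_peMr//.
    by rewrite mulr_ge0// exprn_ge0// ltW.
  by rewrite exprn_ege1//; lra.
pose P i := [set t | `|x + a * pareto (m + i)%N + w t| <= 5^-1].
pose Q i := [set t | `|x - a * pareto (m + i)%N + w t| <= 5^-1].
have mP i : measurable (P i) by exact: measurable_ball.
have mQ i : measurable (Q i) by exact: measurable_ball.
have sep i j (e e' : bool) t : `|x + (-1) ^+ e * (a * pareto (m + i)%N) + w t| <= 5^-1 ->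
    `|x + (-1) ^+ e' * (a * pareto (m + j)%N) + w t| <= 5^-1 -> i = j.
  move=> hi hj; apply/eqP; case: eqP => // /eqP ij.
  have mij : (m + i != m + j)%N by rewrite eqn_add2l.
  have := pareto_separated e e' mij (big i) (big j).
  set z := _ * _ in hi *; set z' := (-1) ^+ e' * _ in hj *.
  have := ler_normB (x + z + w t) (x + z' + w t).
  by rewrite (_ : x + z + w t - (x + z' + w t) = z - z'); [lra|ring].
have -> : \sum_(i < N) (pr (P i) + pr (Q i)) = \sum_(i < N) pr (P i `|` Q i).
  apply: eq_bigr => i _; rewrite pr_disjointU//; try exact: measurable_I01I.
  move=> t _; rewrite /P /Q /= => hp hq.
  have : `|2 * (a * pareto (m + i))| <= 2 / 5.
    have := ler_normB (x + a * pareto (m + i) + w t) (x - a * pareto (m + i) + w t).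
    set z := a * _ in hp hq *.
    by rewrite (_ : x + z + w t - (x - z + w t) = 2 * z); [lra|ring].
  rewrite normrM [`|2|]ger0_norm// normrM [`|pareto _|]ger0_norm; last first.
    by rewrite exprn_ge0// ltW.
  by have := big i; rewrite /pareto; lra.
rewrite -(@pr_bigU_disjoint _ (fun i => P i `|` Q i)).
- by apply: pr_le1; apply: measurable_I01I; apply: bigsetU_measurable => i _; exact: measurableU.
- by move=> i; exact: measurableU.
apply/trivIsetP => i j _ _ ij; rewrite -subset0 => t [hi hj].
move: ij => /eqP; apply.
have cover l : (P l `|` Q l) t -> exists e : bool,
    `|x + (-1) ^+ e * (a * pareto (m + l)%N) + w t| <= 5^-1.
  by case=> h; [exists false|exists true]; rewrite ?expr0 ?expr1 ?mul1r ?mulN1r.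
have [e he] := cover _ hi; have [e' he'] := cover _ hj.
exact: sep he he'.
Qed.

(** Induction on the number of steps.  If the first step is below size 1, the
    induction hypothesis applies to the rest, from a new starting point.  If
    not, the events attached to its values are disjoint and each value has
    probability at most [2^(-m) / 4], a quarter of the probability [2^(-m)] of
    being in this case: the contribution is at most [2^(-m) / 4] whatever the
    other steps do. *)
Lemma heavy_small_ball n a x :
  pr [set t | `|x + W n a t| <= 5^-1] <=
  expR (- (psum r a n / 2)) + 4^-1.
Proof.
have mw n' a' := measurable_walk heavy_scheme n' a'.
have mB n' a' x' : measurable [set t | `|x' + W n' a' t| <= 5^-1].
  exact: measurable_ball.
elim: n a x => [|n IH] a x.
  rewrite /psum big_ord0 mul0r oppr0 expR0.
  apply: le_trans (pr_le1 (measurable_I01I (mB 0%N a x))) _; lra.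
set E := expR (- (psum r (fun i => a i.+1) n / 2)).
have E0 : 0 <= E by exact: expR_ge0.
pose F k := v k *
  (pr [set t | `|x + a 0%N * pareto k + W n (fun i => a i.+1) t| <= 5^-1] +
  pr [set t | `|x - a 0%N * pareto k + W n (fun i => a i.+1) t| <= 5^-1]).
have vge0 k : 0 <= v k by exact: scheme_weight_ge0 heavy_scheme k.
have F0 k : 0 <= F k by rewrite mulr_ge0// addr_ge0// pr_ge0.
have FE k : F k <= 2 * v k * (E + 4^-1).
  have h1 := IH (fun i => a i.+1) (x + a 0%N * pareto k).
  have h2 := IH (fun i => a i.+1) (x - a 0%N * pareto k).
  have := ler_wpM2l (vge0 k) (lerD h1 h2); rewrite -/E -/(F k); lra.
have sumF N : \sum_(k < N) F k <= expR (- (psum r a n.+1 / 2)) + 4^-1; last first.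
  apply: (pr_partition_le (K := level (@dyadic R))) => [k||N].
  - exact: scheme_index_measurable heavy_scheme k.
  - exact: mB.
  apply: le_trans (sumF N); apply: ler_sum => k _.
  rewrite (scheme_fiber (F := fun z => [set t |
    `|x + a 0%N * z + W n (fun i => a i.+1) t| <= 5^-1]) heavy_scheme).
  - by rewrite mulrN.
  - exact: mB.
  - by move=> z; exact: mB.
  - by move=> t /=; rewrite addrA.
have EE : expR (- (psum r a n.+1 / 2)) = expR (- (`|a 0%N| `^ r / 2)) * E.
  by rewrite -expRD psum_shift; congr expR; lra.
have [a0|a0] := eqVneq (a 0%N) 0.
  rewrite EE a0 normr0 powR0 ?gt_eqF// mul0r oppr0 expR0 mul1r.
  apply: (@le_trans _ _ ((\sum_(k < N) 2 * v k) * (E + 4^-1))).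
    by rewrite mulr_suml; apply: ler_sum.
  by rewrite ler_piMl ?(scheme_weight_sum heavy_scheme)//; lra.
have [m [am em]] := level_crossing a0.
(* Levels below [m] give steps smaller than 1, the others steps of size at
   least 1. *)
apply: (@le_trans _ _ (\sum_(k < m + N) F k)).
  rewrite addnC big_split_ord/= lerDl; exact: sumr_ge0.
rewrite big_split_ord/=.
have s1 : \sum_(i < m) F i <= (1 - 2^-1 ^+ m) * (E + 4^-1).
  apply: (@le_trans _ _ ((\sum_(k < m) 2 * v k) * (E + 4^-1))).
    by rewrite mulr_suml; apply: ler_sum.
  rewrite le_eqVlt; apply/orP; left; apply/eqP; congr (_ * _).
  elim: m {am em} => [|m' IHm]; first by rewrite big_ord0 expr0 subrr.
  by rewrite big_ord_recr/= IHm weight_dyadic exprS; lra.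
have s2 : \sum_(i < N) F (m + i)%N <= 2^-1 ^+ m / 4.
  have := sum_pr_translates x N (mw n (fun i => a i.+1)) am.
  have vm : 0 <= 2^-1 ^+ m / 4 :> R by rewrite divr_ge0// exprn_ge0.
  move=> /(ler_wpM2l vm); rewrite mulr1; apply: le_trans; rewrite mulr_sumr.
  apply: ler_sum => i _; apply: ler_wpM2r; first by rewrite addr_ge0// pr_ge0.
  rewrite weight_dyadic ler_wpM2r// exprD ler_piMr ?exprn_ge0//.
  by rewrite exprn_ile1//; lra.
rewrite EE; have := ler_wpM2r E0 em; set g := 2^-1 ^+ m in s1 s2 em *; lra.
Qed.

(** Rescaling to [psum = 14] makes the exponential in [heavy_small_ball] at most
    [exp (- 7) <= 1/8], and each of two small-ball events has probability at
    most 3/8. *)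
Definition heavy_radius : R := 14 `^ (- r^-1) / 5.

Lemma heavy_joint_ge n a b (A B : R) : 0 < A -> 0 < B ->
  A `^ r <= psum r a n -> B `^ r <= psum r b n ->
  4^-1 <= pr [set t | heavy_radius * A < `|W n a t| /\
    heavy_radius * B < `|W n b t|].
Proof.
move=> A0 B0 aA bB.
have mw n' a' := measurable_walk heavy_scheme n' a'.
have small a' (A' : R) : 0 < A' -> A' `^ r <= psum r a' n ->
    pr [set t | `|0 + W n a' t| <= heavy_radius * A'] <= 3 / 8.
  move=> A0' aA'; pose l := 14 `^ r^-1 / A'.
  have l0 : 0 < l by rewrite divr_gt0// powR_gt0.
  have -> : [set t | `|0 + W n a' t| <= heavy_radius * A'] =
      [set t | `|0 + W n (fun i => l * a' i) t| <= 5^-1].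
    apply/funext => t /=; rewrite !add0r walk_scale normrM (gtr0_norm l0).
    have -> : heavy_radius * A' = 5^-1 / l.
      by rewrite /heavy_radius /l powRN; field; rewrite !gt_eqF// powR_gt0.
    by rewrite ler_pdivlMr// mulrC.
  apply: le_trans (heavy_small_ball _ _ _) _; rewrite psum_scale ?(ltW l0)//.
  have h : 14 <= l `^ r * psum r a' n.
    apply: (@le_trans _ _ (l `^ r * A' `^ r)); last by rewrite ler_wpM2l// powR_ge0.
    rewrite -powRM ?(ltW l0) ?(ltW A0')// /l mulfVK ?gt_eqF//.
    by rewrite -powRrM mulVf ?gt_eqF// powRr1.
  have : expR (- (l `^ r * psum r a' n / 2)) <= 8^-1.
    rewrite expRN lef_pV2 ?posrE ?expR_gt0//.
    by apply: le_trans (expR_ge1Dx _); lra.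
  lra.
set G := [set t | _ /\ _].
pose P (a' : nat -> R) (A' : R) :=
  [set t | `|0 + W n a' t| <= heavy_radius * A'].
have mP a' A' : measurable (P a' A') by exact: measurable_ball.
have GE : G = ~` (P a A `|` P b B).
  apply/seteqP; split => t; rewrite /G /P/= !add0r.
    by move=> [h1 h2] []; rewrite leNgt ?h1 ?h2.
  by move=> /not_orP[/negP + /negP]; rewrite -!ltNge.
have mU : measurable (P a A `|` P b B) by exact: measurableU.
rewrite GE pr_setC; [|exact: measurable_I01I|by apply: measurable_I01I; exact: measurableC].
have := pr_union (measurable_I01I (mP a A)) (measurable_I01I (mP b B)).
have := small a A A0 aA; have := small b B B0 bB; rewrite -/(P a A) -/(P b B); lra.
Qed.

End heavy_tail.

Theorem ell_r_case (R : realType) (p : R) (q : \bar R) (r : R) :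
  1 <= p -> (1 <= q)%E -> p < r -> r < 2 ->
  exists E : set (R -> R), copy_of_ell p q r E /\ stable_phase_retrieval p q E.
Proof.
move=> p1 q1 pr_ r2; have r1 : 1 < r by exact: le_lt_trans p1 pr_.
apply: (@series_range_copy_spr _ p q r p1 q1 (ltW r1) _ _ _ _ _ (heavy_scheme r)
  r (moment_coef r) (heavy_radius r) 4^-1 pr_).
- by have := moment_coef_ge1 r1 r2; lra.
- by rewrite /heavy_radius divr_gt0// powR_gt0.
- by [].
- by lra.
- by move=> n a A s; exact: heavy_exit_le.
- by move=> n a b A B; exact: heavy_joint_ge.
Qed.

(** * Bounded steps: the space l_2 *)

Section light_tail.
Context {R : realType}.
Implicit Types (a b : nat -> R) (x z : R).

Definition cosh x : R := (expR x + expR (- x)) / 2.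

Lemma cosh_ge1 x : 1 <= cosh x.
Proof. by rewrite /cosh; have := expR_ge1Dx x; have := expR_ge1Dx (- x); lra. Qed.

Lemma coshDB x h : cosh (x + h) + cosh (x - h) = 2 * cosh x * cosh h.
Proof. by rewrite /cosh !opprD opprK !expRD; field. Qed.

Lemma cosh_ge_expR x : expR `|x| <= 2 * cosh x.
Proof.
rewrite /cosh; have := expR_gt0 x; have := expR_gt0 (- x).
by case: (ger0P x) => _; lra.
Qed.

(** For [x^2 <= 1/4] compare with [1 / (1 - x^2)], using only [1 + y <= exp y];
    otherwise [|x| <= 2 x^2]. *)
Lemma cosh_le x : cosh x <= expR (2 * x ^+ 2).
Proof.
have e0 := expR_gt0 x; have e0' := expR_gt0 (- x).
have [x2|x2] := leP (x ^+ 2) (1 / 4).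
  apply: le_trans (expR_ge1Dx _).
  have xs : - (1 / 2) <= x <= 1 / 2 by apply/andP; split; nra.
  have h1 : expR x * (1 - x) <= 1.
    have := ler_wpM2l (ltW e0) (expR_ge1Dx (- x)).
    by rewrite -expRD subrr expR0.
  have h2 : expR (- x) * (1 + x) <= 1.
    have := ler_wpM2l (ltW e0') (expR_ge1Dx x).
    by rewrite -expRD addNr expR0.
  have [x1 x3] := andP xs.
  have k1 : expR x * ((1 - x) * (1 + x)) <= 1 + x.
    by rewrite mulrA -[leRHS]mul1r ler_wpM2r//; lra.
  have k2 : expR (- x) * ((1 - x) * (1 + x)) <= 1 - x.
    by rewrite [(1 - x) * _]mulrC mulrA -[leRHS]mul1r ler_wpM2r//; lra.
  have k3 : cosh x * (1 - x ^+ 2) <= 1 by rewrite /cosh; lra.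
  have k4 : 0 < 1 - x ^+ 2 by lra.
  by rewrite -(ler_pM2r k4); apply: le_trans k3 _; have := sqr_ge0 x; nra.
apply: (@le_trans _ _ (expR `|x|)).
  rewrite /cosh; have h1 := ler_norm x; have h2 := ler_norm (- x).
  rewrite normrN in h2; move: h1 h2; rewrite -(ler_expR x) -(ler_expR (- x)); lra.
rewrite ler_expR -real_normK ?num_real//.
have : x ^+ 2 = `|x| ^+ 2 by rewrite real_normK ?num_real.
have := normr_ge0 x; set y := `|x|; nra.
Qed.

(** Only two nondegenerate intervals: [3/4, 1[ carries the values 2 and -2, and
    [0, 3/4[ the value 0. *)
Definition quarter (k : nat) : R := if k is k'.+1 then if k' is 0%N then 3 / 4 else 0 else 1.
Definition spike (k : nat) : R := if k is 0%N then 2 else 0.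
Definition light_digit := digit quarter spike.
Definition light_shift := shift quarter.
Notation v := (weight quarter).
Notation W := (walk light_digit light_shift).

Lemma light_scheme : symmetric_scheme light_digit light_shift (level quarter) v spike.
Proof.
apply: bernoulli_symmetric_scheme => //.
- by case=> [|[|k]] /=; lra.
- by case=> [|[|k]] //=; lra.
- by move=> t t0; exists 2%N => /=; exact: ltW.
Qed.

Lemma measurable_both_exceed n a b x z (s s' : R) :
  measurable [set t | s < `|x + W n a t| /\ s' < `|z + W n b t|].
Proof.
have m1 (c : nat -> R) (y u : R) : measurable [set t | u < `|y + W n c t|].
  rewrite -[X in measurable X]setTI.
  apply: (@measurable_fun_ltr _ _ _ _ (cst u) (fun t => `|y + W n c t|)) => //.
  apply: measurableT_comp => //; apply: measurable_funD => //.
  exact: measurable_walk light_scheme n c.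
exact: measurableI (m1 a x s) (m1 b z s').
Qed.

Lemma light_exit_le n a x s :
  pr (exit_event light_digit light_shift n a x s) <= 2 * expR (- s) * (cosh x * expR (8 * psum 2 a n)).
Proof.
have pos s' x' P : 0 <= 2 * expR (- s') * (cosh x' * expR (8 * P)).
  have c0 : 0 <= cosh x' by have := cosh_ge1 x'; lra.
  by apply: mulr_ge0; apply: mulr_ge0 => //; exact: expR_ge0.
apply: (@pr_exit_le _ _ _ _ _ _ light_scheme
   (fun n a x => 2 * expR (- s) * (cosh x * expR (8 * psum 2 a n)))) => {n a x}.
- by move=> n a x; exact: pos.
- move=> n a x sx; have h := cosh_ge_expR x.
  have h1 : expR s <= 2 * cosh x by apply: le_trans h; rewrite ler_expR.
  have h2 : 1 <= expR (8 * psum 2 a n).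
    by rewrite -[leLHS]expR0 ler_expR mulr_ge0// psum_ge0.
  have h3 : 1 <= expR (- s) * (2 * cosh x).
    by rewrite -[leLHS](@expRxMexpNx_1 _ s) mulrC ler_wpM2l ?expR_ge0.
  rewrite (_ : _ * _ = (expR (- s) * (2 * cosh x)) * expR (8 * psum 2 a n)); last by ring.
  by rewrite -[leLHS]mulr1; apply: ler_pM.
move=> n a x N; rewrite psum_shift; set P := psum 2 _ n.
have -> : `|a 0%N| `^ 2 = a 0%N ^+ 2 by rewrite powR_mulrn// real_normK// num_real.
rewrite mulrDr expRD.
have c0 : 0 <= cosh x by have := cosh_ge1 x; lra.
set G := 2 * expR (- s) * (cosh x * expR (8 * P)).
have G0 : 0 <= G by exact: pos.
apply: (@le_trans _ _ (\sum_(k < N) 2 * v k * (G * expR (8 * a 0%N ^+ 2)))).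
  apply: ler_sum => k _.
  have vk : 0 <= v k by exact: scheme_weight_ge0 light_scheme k.
  have ck : cosh (a 0%N * spike k) <= expR (8 * a 0%N ^+ 2).
    apply: le_trans (cosh_le _) _; rewrite ler_expR.
    by rewrite /spike; case: (k : nat) => [|?]; have := sqr_ge0 (a 0%N); nra.
  rewrite -!mulrDr -mulrDl coshDB.
  rewrite (_ : v k * _ = 2 * v k * (G * cosh (a 0%N * spike k))); last by rewrite /G; ring.
  by apply: ler_wpM2l; [rewrite mulr_ge0|rewrite ler_wpM2l].
rewrite -mulr_suml; apply: (@le_trans _ _ (G * expR (8 * a 0%N ^+ 2))).
  rewrite ler_piMl ?(scheme_weight_sum light_scheme)//.
  by rewrite mulr_ge0// expR_ge0.
by rewrite le_eqVlt; apply/orP; left; apply/eqP; rewrite /G; ring.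
Qed.

Lemma expR_ge_powX (M : nat) x : (0 < M)%N -> 0 <= x -> (x / M%:R) ^+ M <= expR x.
Proof.
move=> M0 x0; have Mp : 0 < M%:R :> R by rewrite ltr0n.
rewrite -[x in leRHS](divfK (lt0r_neq0 Mp)) expRM_natr.
apply: lerXn2r; rewrite ?nnegrE ?expR_ge0 ?divr_ge0 ?ler0n//.
by have := expR_ge1Dx (x / M%:R); lra.
Qed.

(** From [exp (- u) <= (M / u)^M]. *)
Definition exit_coef (M : nat) : R := 2 * expR 8 * M%:R ^+ M.

Lemma light_exit_power (M : nat) n a (A s : R) : (0 < M)%N -> 0 < A -> 0 < s ->
  psum 2 a n <= A `^ 2 ->
  pr (exit_event light_digit light_shift n a 0 s) <= exit_coef M * (A / s) `^ M%:R.
Proof.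
move=> M0 A0 s0 aA; have Ai : 0 < A^-1 by rewrite invr_gt0.
rewrite (exit_event_scale _ _ _ _ _ Ai); apply: le_trans (light_exit_le _ _ _ _) _.
have -> : cosh 0 = 1 by rewrite /cosh oppr0 expR0; lra.
rewrite mul1r psum_scale ?(ltW Ai)//.
have As : 0 < A^-1 * s by rewrite mulr_gt0.
have Mp : 0 < M%:R :> R by rewrite ltr0n.
have h1 : expR (8 * (A^-1 `^ 2 * psum 2 a n)) <= expR 8.
  rewrite ler_expR ler_piMr//.
  apply: (@le_trans _ _ (A^-1 `^ 2 * A `^ 2)); first by rewrite ler_wpM2l// powR_ge0.
  by rewrite -powRM ?(ltW Ai) ?(ltW A0)// mulVf ?gt_eqF// powR1.
have h2 : expR (- (A^-1 * s)) <= (M%:R / (A^-1 * s)) ^+ M.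
  rewrite expRN -[leRHS]invrK -exprVn invf_div lef_pV2 ?posrE ?expR_gt0//.
    exact: expR_ge_powX (ltW As).
  by rewrite exprn_gt0// divr_gt0.
have E0 := expR_ge0 (- (A^-1 * s)); have E1 := expR_ge0 (8 : R).
have -> : exit_coef M * (A / s) `^ M%:R = 2 * (M%:R / (A^-1 * s)) ^+ M * expR 8.
  rewrite powR_mulrn ?divr_ge0 ?(ltW A0) ?(ltW s0)//.
  rewrite (_ : M%:R / (A^-1 * s) = M%:R * (A / s)); last by field; rewrite !gt_eqF.
  rewrite [(M%:R * _) ^+ M]exprMn /exit_coef.
  by move: (M%:R ^+ M) ((A / s) ^+ M) (expR 8) => x1 x2 x3; ring.
by apply: ler_pM; rewrite ?expR_ge0 ?mulr_ge0// ler_pM2l.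
Qed.

Definition dot a b n : R := \sum_(i < n) a i * b i.

Definition pow8_coef : R := 2 * 8 ^+ 8.
Definition corr_coef : R := 2 / (pow8_coef * expR 8).
(** The choice of [corr_coef] makes [tail_coef] equal to
    [corr_coef^2 * pow8_coef / 8], as the pointwise bound [corr_bound0] requires,
    while [2 * tail_coef * expR 8] is only half of [corr_coef]. *)
Definition tail_coef : R := corr_coef / (4 * expR 8).

Lemma corr_coef_gt0 : 0 < corr_coef.
Proof. by rewrite /corr_coef divr_gt0// mulr_gt0 ?expR_gt0// /pow8_coef mulr_gt0// exprn_gt0. Qed.

Lemma corr_coef_le1 : corr_coef <= 1.
Proof.
have e1 : 1 <= expR 8 :> R by rewrite -[leLHS]expR0 ler_expR.
have h1 : 2 <= pow8_coef by rewrite /pow8_coef ler_peMr// exprn_ege1//; lra.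
rewrite /corr_coef ler_pdivrMr ?mul1r; last by rewrite mulr_gt0 ?expR_gt0//; lra.
by rewrite -[leLHS]mulr1; apply: ler_pM.
Qed.

Lemma pow8_le_cosh x : x ^+ 8 <= pow8_coef * cosh x.
Proof.
have h := @expR_ge_powX 8 `|x| isT (normr_ge0 x).
have h2 := cosh_ge_expR x.
have xe : x ^+ 8 = `|x| ^+ 8.
  by rewrite (exprM x 2 4) (exprM `|x| 2 4) real_normK ?num_real.
have e8 : 0 <= 8 ^+ 8 :> R by rewrite exprn_ge0.
rewrite xe -[`|x| in leLHS](divfK (_ : 8 != 0 :> R)) ?pnatr_eq0// exprMn.
apply: (@le_trans _ _ (2 * cosh x * 8 ^+ 8)); last by rewrite /pow8_coef; lra.
by rewrite ler_wpM2r//; exact: le_trans h h2.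
Qed.

(** A lower bound for the expectation, over the two walks started at [x] and [z],
    of [corr_coef * u^2 w^2 - corr_coef / 16 * (u^2 + w^2) - tail_coef *
    (cosh u + cosh w)].  This function is at most 1, and at most 0 unless both
    |u| and |w| exceed 1/4, so its expectation is at most the probability
    of that event.  The first bracket is the moment of order (2,2) for steps
    with fourth moment 3, the second is exact, and the last uses the exponential
    moment. *)
Definition corr_bound n a b x z : R :=
  let A := psum 2 a n in let B := psum 2 b n in let P := dot a b n in
  corr_coef * (x ^+ 2 * z ^+ 2 + x ^+ 2 * B + z ^+ 2 * A + 4 * x * z * P + A * B + 2 * P ^+ 2)
  - corr_coef / 16 * (x ^+ 2 + z ^+ 2 + A + B)
  - tail_coef * (cosh x * expR (8 * A) + cosh z * expR (8 * B)).

Lemma corr_bound0 a b x z :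
  corr_bound 0 a b x z <= if (4^-1 < `|x|) && (4^-1 < `|z|) then 1 else 0.
Proof.
have a0 := corr_coef_gt0; have e0 := expR_gt0 (8 : R).
have g0 : 0 < tail_coef by rewrite /tail_coef divr_gt0// mulr_gt0.
have c1 := cosh_ge1 x; have c2 := cosh_ge1 z.
rewrite /corr_bound /psum /dot !big_ord0 !mulr0 expr0n/= !mulr0 !addr0 expR0 !mulr1.
case: ifPn => [_|].
  have k1 := pow8_le_cosh x; have k2 := pow8_le_cosh z.
  have gE : tail_coef = corr_coef ^+ 2 * pow8_coef / 8.
    by rewrite /tail_coef /corr_coef; field; rewrite !gt_eqF// /pow8_coef mulr_gt0// exprn_gt0.
  have u2 : (x ^+ 2 * z ^+ 2) ^+ 2 <= (x ^+ 8 + z ^+ 8) / 2.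
    have := sqr_ge0 (x ^+ 4 - z ^+ 4).
    rewrite (_ : x ^+ 8 = (x ^+ 4) ^+ 2) -?exprM// (_ : z ^+ 8 = (z ^+ 4) ^+ 2) -?exprM//.
    by rewrite exprMn -!exprM /=; nra.
  set u := x ^+ 2 * z ^+ 2 in u2 *.
  (* Completing the square, and then [u^2 <= (x^8 + z^8) / 2]. *)
  have h1 : corr_coef * u <= 1 + corr_coef ^+ 2 * u ^+ 2 / 4.
    have := sqr_ge0 (corr_coef * u / 2 - 1); nra.
  have h2 : corr_coef ^+ 2 * u ^+ 2 / 4 <= tail_coef * (cosh x + cosh z).
    have a2 : 0 <= corr_coef ^+ 2 / 4 by rewrite divr_ge0// sqr_ge0.
    have h3 : u ^+ 2 <= pow8_coef * (cosh x + cosh z) / 2 by lra.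
    have := ler_wpM2l a2 h3; rewrite gE; lra.
  have : 0 <= corr_coef / 16 * (x ^+ 2 + z ^+ 2).
    by rewrite mulr_ge0 ?addr_ge0 ?sqr_ge0// divr_ge0// ltW.
  lra.
rewrite negb_and -!leNgt => small.
have : 0 <= tail_coef * (cosh x + cosh z) by rewrite mulr_ge0 ?(ltW g0)//; lra.
have sq w : `|w| <= 4^-1 -> w ^+ 2 <= 16^-1 :> R.
  move=> w4; rewrite -real_normK ?num_real//.
  by have := normr_ge0 w; nra.
have x2 := sqr_ge0 x; have z2 := sqr_ge0 z.
have : x ^+ 2 * z ^+ 2 <= 16^-1 * (x ^+ 2 + z ^+ 2).
  by case/orP: small => /sq h; nra.
move=> /(ler_wpM2l (ltW a0)); lra.
Qed.

(** The step has moments E X = E X^3 = 0, E X^2 = 1 and E X^4 = 4; the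
    loss comes from E X^4 >= 3 and from E cosh (y X) <= exp (8 y^2). *)
Lemma corr_boundS n a b x z (a' := fun i => a i.+1) (b' := fun i => b i.+1) :
  corr_bound n.+1 a b x z <=
  1 / 8 * (corr_bound n a' b' (x + a 0%N * 2) (z + b 0%N * 2) +
           corr_bound n a' b' (x - a 0%N * 2) (z - b 0%N * 2)) +
  3 / 4 * corr_bound n a' b' x z.
Proof.
have a0 := corr_coef_gt0; have e0 := expR_gt0 (8 : R).
have g0 : 0 < tail_coef by rewrite /tail_coef divr_gt0// mulr_gt0.
have s2 (w : R) : `|w| `^ 2 = w ^+ 2 by rewrite powR_mulrn// real_normK// num_real.
rewrite /corr_bound !psum_shift !s2 /dot big_ord_recl/= -/a' -/b'.
rewrite -/(dot a' b' n); set P := dot _ _ _.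
set A := psum 2 a' n; set B := psum 2 b' n; set u := a 0%N; set w := b 0%N.
have ch y : 1 / 8 * (2 * cosh (y * 2)) + 3 / 4 <= expR (8 * y ^+ 2).
  have := cosh_le (y * 2); rewrite (_ : 2 * (y * 2) ^+ 2 = 8 * y ^+ 2); last by ring.
  have : 1 <= expR (8 * y ^+ 2) by rewrite -[leLHS]expR0 ler_expR mulr_ge0// sqr_ge0.
  lra.
have co y t Q : 1 / 8 * (cosh (t + y * 2) * expR (8 * Q) + cosh (t - y * 2) * expR (8 * Q)) +
    3 / 4 * (cosh t * expR (8 * Q)) <= cosh t * expR (8 * (y ^+ 2 + Q)).
  rewrite -mulrDl coshDB [8 * (_ + _)]mulrDr expRD.
  have ct := cosh_ge1 t; have eq := expR_ge0 (8 * Q).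
  have tq : 0 <= cosh t * expR (8 * Q) by rewrite mulr_ge0//; lra.
  have := ler_wpM2l tq (ch y); lra.
have hx := ler_wpM2l (ltW g0) (co u x A); have hz := ler_wpM2l (ltW g0) (co w z B).
have uw : 0 <= corr_coef * (u ^+ 2 * w ^+ 2) 
  by apply: mulr_ge0; [exact: ltW|apply: mulr_ge0; exact: sqr_ge0].
move: hx hz uw.
lra.
Qed.

Lemma corr_bound_le_pr n a b x z :
  corr_bound n a b x z <= pr [set t | 4^-1 < `|x + W n a t| /\
     4^-1 < `|z + W n b t|].
Proof.
elim: n a b x z => [|n IH] a b x z.
  apply: le_trans (corr_bound0 a b x z) _; case: ifPn => [/andP[hx hz]|_]; last exact: pr_ge0.
  rewrite (_ : [set t | _] = setT) ?prT//.
  by apply/seteqP; split => // t _ /=; rewrite !addr0.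
set a' := fun i => a i.+1; set b' := fun i => b i.+1.
set G := [set t | _].
pose F (y : R) := [set t | 4^-1 < `|(x + a 0%N * y) + W n a' t| /\
     4^-1 < `|(z + b 0%N * y) + W n b' t|].
have mGG : measurable G by exact: measurable_both_exceed.
have fib k : pr (G `&` level quarter @^-1` [set k]) = v k * (pr (F (spike k)) + pr (F (- spike k))).
  apply: (scheme_fiber (F := F) light_scheme) => // [y|t]; first exact: measurable_both_exceed.
  by rewrite /G /F /= !addrA.
have mK k : measurable (G `&` level quarter @^-1` [set k]).
  by apply: measurableI => //; exact: scheme_index_measurable light_scheme k.
have : pr (G `&` level quarter @^-1` [set 0%N]) + pr (G `&` level quarter @^-1` [set 1%N]) <= pr G.
  rewrite -pr_disjointU; try exact: measurable_I01I.
    apply: le_pr; [by apply: measurable_I01I; exact: measurableU|exact: measurable_I01I|].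
    by move=> t _ [[]|[]].
  by move=> t _ [_ /= ->] [].
rewrite !fib /= oppr0.
have := IH a' b' (x + a 0%N * 2) (z + b 0%N * 2).
have := IH a' b' (x + a 0%N * - 2) (z + b 0%N * - 2).
have := IH a' b' (x + a 0%N * 0) (z + b 0%N * 0).
rewrite -/(F 2) -/(F (- 2)) -/(F 0) !mulr0 !addr0 !mulrN.
have := corr_boundS n a b x z; rewrite -/a' -/b'.
rewrite /weight/=; lra.
Qed.

(** Normalise both sequences to have [psum = 1]; then the correlation bound from the
    origin is at least [corr_coef (1 - 1/8 - 1/2)]. *)
Lemma light_joint_ge n a b (A B : R) : 0 < A -> 0 < B ->
  A `^ 2 <= psum 2 a n -> B `^ 2 <= psum 2 b n ->
  corr_coef / 4 <= pr [set t | 4^-1 * A < `|W n a t| /\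
    4^-1 * B < `|W n b t|].
Proof.
move=> A0 B0 aA bB.
have mw n' a' := measurable_walk light_scheme n' a'.
have norm_ge (c : nat -> R) (C : R) : 0 < C -> C `^ 2 <= psum 2 c n ->
   exists2 l : R, 0 < l & l * C <= 1 /\ psum 2 (fun i => l * c i) n = 1.
  move=> C0 cC; have p0 : 0 < psum 2 c n by apply: lt_le_trans cC; rewrite powR_gt0.
  pose N := psum 2 c n `^ 2^-1; have N0 : 0 < N by rewrite powR_gt0.
  have N2 : N `^ 2 = psum 2 c n by rewrite /N -powRrM mulVf ?powRr1// ltW.
  exists N^-1; first by rewrite invr_gt0.
  split.
    rewrite mulrC ler_pdivrMr// mul1r -[C]powRr1 ?(ltW C0)// -(@mulfV _ (2 : R))// powRrM /N.
    by apply: ge0_ler_powR; rewrite ?nnegrE ?powR_ge0 ?psum_ge0.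
  rewrite psum_scale ?invr_ge0 ?(ltW N0)// -N2 -powRM ?invr_ge0 ?(ltW N0)//.
  by rewrite mulVf ?gt_eqF// powR1.
have [l l0 [lA pa]] := norm_ge a A A0 aA; have [k k0 [kB pb]] := norm_ge b B B0 bB.
have low := corr_bound_le_pr n (fun i => l * a i) (fun i => k * b i) 0 0.
apply: le_trans (le_trans low _).
  rewrite /corr_bound pa pb expr0n /= !mul0r !mulr0 !mul0r !add0r !mul1r mulr1.
  have -> : cosh 0 = 1 by rewrite /cosh oppr0 expR0; lra.
  have : 0 <= corr_coef * (dot (fun i => l * a i) (fun i => k * b i) n) ^+ 2.
    by rewrite mulr_ge0 ?sqr_ge0// ltW// corr_coef_gt0.
  have : tail_coef * expR 8 = corr_coef / 4 by rewrite /tail_coef; field; rewrite gt_eqF// expR_gt0.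
  have := corr_coef_gt0; lra.
have scale (c : nat -> R) (h C t : R) : 0 < h -> h * C <= 1 ->
    4^-1 < `|0 + W n (fun i => h * c i) t| ->
    4^-1 * C < `|W n c t|.
  move=> h0 hC; rewrite add0r walk_scale normrM (gtr0_norm h0) => ht.
  by rewrite -(ltr_pM2l h0); apply: le_lt_trans ht; lra.
apply: le_pr.
- by apply: measurable_I01I; exact: measurable_both_exceed.
- apply: measurable_I01I; have := measurable_both_exceed n a b 0 0 (4^-1 * A) (4^-1 * B).
  by congr measurable; apply/funext => t /=; rewrite !add0r.
by move=> t _ [h1 h2]; split; [exact: scale h1|exact: scale h2].
Qed.

End light_tail.

Theorem ell_2_case (R : realType) (p : R) (q : \bar R) : 1 <= p -> (1 <= q)%E ->
  exists E : set (R -> R), copy_of_ell p q 2 E /\ stable_phase_retrieval p q E.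
Proof.
move=> p1 q1; pose M := Num.bound p.
have pM : p < M%:R by apply: archi_boundP; exact: le_trans ler01 p1.
have M0 : (0 < M)%N by rewrite -(ltr0n R); apply: lt_trans pM; exact: lt_le_trans ltr01 p1.
have le12 : 1 <= 2 :> R by rewrite ler1n.
apply: (@series_range_copy_spr _ p q 2 p1 q1 le12 _ _ _ _ _ light_scheme
  M%:R (exit_coef M) 4^-1 (corr_coef / 4) pM).
- by rewrite /exit_coef !mulr_gt0 ?expR_gt0// exprn_gt0// ltr0n.
- by [].
- by rewrite divr_gt0// corr_coef_gt0.
- by have := @corr_coef_le1 R; have := @corr_coef_gt0 R; lra.
- by move=> n a A s; exact: light_exit_power.
- by move=> n a b A B; exact: light_joint_ge.
Qed.

Theorem proposition4p10 (R : realType) (p : R) (q : \bar R)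
    (p_ge1 : 1 <= p) (q_ge1 : (1 <= q)%E) (p1_qfin : p = 1 -> (q < +oo)%E) :
  (exists E : set (R -> R),
     copy_of_ell p q 2 E /\ stable_phase_retrieval p q E) /\
  (forall r : R, p < r -> r < 2 ->
     exists E : set (R -> R),
       copy_of_ell p q r E /\ stable_phase_retrieval p q E).
Proof.
split; first exact: ell_2_case.
by move=> r pr_ r2; exact: ell_r_case.
Qed.
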